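(* Let $I=[0,1]$ or $I=[0,\infty)$. The spaces $Ces_1[0,1]$, $Ces_\infty(I)$, $Cop_1(I)$, $Cop_\infty(I)$, and every nontrivial Tandori function space $\widetilde X$ (i.e. with $\widetilde X\ne\{0\}$), where $X$ is a Banach function space on $I$, fail to have the weak fixed point property.
   Context: $L^0(I)$ is the space of (a.e. equivalence classes of) real-valued Lebesgue measurable functions on $I$. A Banach function space $X$ on $I$ is a Banach space that is a linear subspace of $L^0(I)$ with the ideal property: $|f|\le|g|$ a.e., $f\in L^0(I)$, $g\in X$ imply $f\in X$ and $\|f\|_X\le\|g\|_X$; by convention $X$ is also assumed to contain a function positive a.e. on $I$ (this is not assumed for the derived spaces). Cesàro operator: $Cf(x)=\frac1x\int_0^x f(t)\,dt$ for $0<x\in I$. Copson operator: $C^*f(x)=\int_{I\cap[x,\infty)}\frac{f(t)}{t}\,dt$ for $x\in I$. For $T\in\{C,C^*\}$: $TX=\{f\in L^0(I): T|f|\in X\}$, $\|f\|_{TX}=\|T|f|\|_X$. $Ces_p=CL^p$ and $Cop_p=C^*L^p$. Tandori space: $\widetilde X=\{f\in L^0(I):\widetilde f\in X\}$, $\|f\|_{\widetilde X}=\|\widetilde f\|_X$, where $\widetilde f(x)=\operatorname{ess\,sup}_{t\in I,\,t\ge x}|f(t)|$. A Banach space $E$ has the weak fixed point property if for every nonempty weakly compact convex $K\subset E$, every nonexpansive map $S:K\to K$ ($\|S(x)-S(y)\|\le\|x-y\|$ for all $x,y\in K$) has a fixed point. *)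

(* Defs.v *)
From HB Require Import structures.
From mathcomp Require Import all_boot all_order all_algebra.
From mathcomp Require Import all_classical all_reals all_analysis.
From mathcomp Require Import measurable_realfun ess_sup_inf.

Set Implicit Arguments.
Unset Strict Implicit.
Unset Printing Implicit Defensive.

Import Order.TTheory GRing.Theory Num.Theory.
Import numFieldNormedType.Exports.

Local Open Scope classical_set_scope.
Local Open Scope ring_scope.

Section WeakFixedPointProperty.
Context {R : realType} (E : normedModType R).

Definition continuous_dual : Type := {phi : {linear E -> R^o} | continuous phi}.

(* The weak topology sigma(E, E'): the coarsest topology making every
   continuous linear functional continuous. *)
Definition weak_space : topologicalType :=
  sup_topology (fun phi : continuous_dual =>
    Topological.class (initial_topology (sval phi : E -> R^o))).

Definition weakly_compact (K : set E) : Prop := compact (K : set weak_space).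

Definition nonexpansive_on (K : set E) (S : E -> E) : Prop :=
  {in K &, forall x y, `|S x - S y| <= `|x - y|}.

(* S is a total map on E, but only its restriction to K, which maps K into
   itself, is constrained. *)
Definition wfpp : Prop :=
  forall K : set E, K !=set0 -> weakly_compact K -> convex_set K ->
  forall S : E -> E, (forall x, K x -> K (S x)) -> nonexpansive_on K S ->
  exists2 x, K x & S x = x.

End WeakFixedPointProperty.

(* A linear subspace of V together with a norm on it; the values of fnorm
   outside carrier are irrelevant.  The associated normed module is fspace. *)
Record normed_subspace (R : realType) (V : lmodType R) := NormedSubspace {
  carrier : set V ;
  fnorm : V -> R ;
  carrier0 : carrier 0 ;
  carrierD : forall f g, carrier f -> carrier g -> carrier (f + g) ;
  carrierZ : forall a f, carrier f -> carrier (a *: f) ;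
  fnormD : forall f g, carrier f -> carrier g ->
    fnorm (f + g) <= fnorm f + fnorm g ;
  fnormZ : forall a f, carrier f -> fnorm (a *: f) = `|a| * fnorm f ;
  fnorm_eq0 : forall f, carrier f -> fnorm f = 0 -> f = 0
}.

Definition fspace_pred (R : realType) (V : lmodType R)
  (A : normed_subspace V) : {pred V} := fun f => f \in carrier A.

Lemma fspace_pred_closed (R : realType) (V : lmodType R)
  (A : normed_subspace V) : subsemimod_closed (fspace_pred A).
Proof.
split; last by move=> a f /set_mem Af; apply/mem_set/carrierZ.
by split=> [|f g /set_mem Af /set_mem Ag]; apply/mem_set;
  [exact: carrier0 | exact: carrierD].
Qed.

HB.instance Definition _ (R : realType) (V : lmodType R)
    (A : normed_subspace V) :=
  GRing.isSubmodClosed.Build R V (fspace_pred A) (fspace_pred_closed A).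

Record fspace (R : realType) (V : lmodType R) (A : normed_subspace V) := FSpace {
  fspace_val : V ;
  _ : fspace_val \in fspace_pred A
}.

Section SpaceInstances.
Context (R : realType) (V : lmodType R) (A : normed_subspace V).
HB.instance Definition _ := [isSub for @fspace_val R V A].
HB.instance Definition _ := [Choice of fspace A by <:].
HB.instance Definition _ := [SubChoice_isSubLmodule of fspace A by <:].

Let norm (x : fspace A) : R := fnorm A (val x).

Let carrierP (x : fspace A) : carrier A (val x).
Proof. exact: set_mem (valP x). Qed.

Let normD x y : norm (x + y) <= norm x + norm y.
Proof. by rewrite /norm raddfD; apply: fnormD; exact: carrierP. Qed.

Let normZ a x : norm (a *: x) = `|a| * norm x.
Proof. by rewrite /norm linearZ; apply: fnormZ; exact: carrierP. Qed.

Let norm0 x : norm x = 0 -> x = 0.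
Proof. by move=> x0; apply/val_inj; rewrite raddf0 (fnorm_eq0 _ x0). Qed.

HB.instance Definition _ :=
  Lmodule_isNormed.Build R (fspace A) normD normZ norm0.

Lemma fspace_normE (x : fspace A) : `|x| = fnorm A (val x).
Proof. by []. Qed.

End SpaceInstances.

(* L0 mu: measurable functions T -> R modulo mu-a.e. equality, with the
   pointwise vector space operations (L0D, L0Z, L00). *)
Section L0.
Context d (T : measurableType d) (R : realType).
Variable mu : {measure set T -> \bar R}.

Definition L0 : Type := {mfun_ mu, T >-> R}.
HB.instance Definition _ := Choice.on L0.
HB.instance Definition _ := EqQuotient.on L0.

Definition L0rep (f : L0) : {mfun T >-> R} := repr f.
Definition L0fun (f : L0) : T -> R := L0rep f.
Coercion L0fun : L0 >-> Funclass.

Definition classL0 (f : {mfun T >-> R}) : L0 := (\pi_L0 f)%qT.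

Lemma measurable_L0 (f : L0) : measurable_fun setT f.
Proof. by rewrite /L0fun; exact: measurable_funP. Qed.

Lemma L0P (f g : L0) : f = g <-> \forall x \ae mu, f x = g x.
Proof.
split=> [->|fg]; first exact/nearW.
rewrite -[f]reprK -[g]reprK; apply/eqP; rewrite eqmodE; apply/asboolP.
by apply: filterS fg => x.
Qed.

Lemma classL0E (f : {mfun T >-> R}) : \forall x \ae mu, classL0 f x = f x.
Proof.
have : repr (classL0 f) == f %[mod L0]%qT by rewrite reprK.
by rewrite eqmodE => /asboolP; apply: filterS => x /(_ I).
Qed.

Let addL0 (f g : L0) := classL0 (L0rep f + L0rep g).
Let oppL0 (f : L0) := classL0 (- L0rep f).
Let scaleL0 (a : R) (f : L0) := classL0 (a *: L0rep f).
Let zeroL0 := classL0 0.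

Let addL0E (f g : L0) : \forall x \ae mu, addL0 f g x = f x + g x.
Proof. exact: classL0E. Qed.

Let oppL0E (f : L0) : \forall x \ae mu, oppL0 f x = - f x.
Proof. exact: classL0E. Qed.

Let scaleL0E a (f : L0) : \forall x \ae mu, scaleL0 a f x = a * f x.
Proof. exact: classL0E. Qed.

Let zeroL0E : \forall x \ae mu, zeroL0 x = 0.
Proof. exact: classL0E. Qed.

Let addL0A : associative addL0.
Proof.
move=> f g h; apply/L0P; near=> x.
have -> : addL0 f (addL0 g h) x = f x + addL0 g h x by near: x; exact: addL0E.
have -> : addL0 (addL0 f g) h x = addL0 f g x + h x by near: x; exact: addL0E.
have -> : addL0 f g x = f x + g x by near: x; exact: addL0E.
have -> : addL0 g h x = g x + h x by near: x; exact: addL0E.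
by rewrite addrA.
Unshelve. all: by end_near. Qed.

Let addL0C : commutative addL0.
Proof.
move=> f g; apply/L0P; near=> x.
have -> : addL0 f g x = f x + g x by near: x; exact: addL0E.
have -> : addL0 g f x = g x + f x by near: x; exact: addL0E.
by rewrite addrC.
Unshelve. all: by end_near. Qed.

Let add0L0 : left_id zeroL0 addL0.
Proof.
move=> f; apply/L0P; near=> x.
have -> : addL0 zeroL0 f x = zeroL0 x + f x by near: x; exact: addL0E.
have -> : zeroL0 x = 0 by near: x; exact: zeroL0E.
by rewrite add0r.
Unshelve. all: by end_near. Qed.

Let addNL0 : left_inverse zeroL0 oppL0 addL0.
Proof.
move=> f; apply/L0P; near=> x.
have -> : addL0 (oppL0 f) f x = oppL0 f x + f x by near: x; exact: addL0E.
have -> : oppL0 f x = - f x by near: x; exact: oppL0E.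
have -> : zeroL0 x = 0 by near: x; exact: zeroL0E.
by rewrite addNr.
Unshelve. all: by end_near. Qed.

HB.instance Definition _ :=
  GRing.isZmodule.Build L0 addL0A addL0C add0L0 addNL0.

Let scaleL0A a b f : scaleL0 a (scaleL0 b f) = scaleL0 (a * b) f.
Proof.
apply/L0P; near=> x.
have -> : scaleL0 a (scaleL0 b f) x = a * scaleL0 b f x.
  by near: x; exact: scaleL0E.
have -> : scaleL0 b f x = b * f x by near: x; exact: scaleL0E.
have -> : scaleL0 (a * b) f x = a * b * f x by near: x; exact: scaleL0E.
by rewrite mulrA.
Unshelve. all: by end_near. Qed.

Let scale1L0 : left_id 1 scaleL0.
Proof.
move=> f; apply/L0P; near=> x.
have -> : scaleL0 1 f x = 1 * f x by near: x; exact: scaleL0E.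
by rewrite mul1r.
Unshelve. all: by end_near. Qed.

Let scaleL0Dr : right_distributive scaleL0 +%R.
Proof.
move=> a f g; apply/L0P; near=> x.
have -> : scaleL0 a (f + g : L0) x = a * (f + g : L0) x by near: x; exact: scaleL0E.
have -> : (f + g : L0) x = f x + g x by near: x; exact: addL0E.
have -> : (scaleL0 a f + scaleL0 a g : L0) x = scaleL0 a f x + scaleL0 a g x.
  by near: x; exact: addL0E.
have -> : scaleL0 a f x = a * f x by near: x; exact: scaleL0E.
have -> : scaleL0 a g x = a * g x by near: x; exact: scaleL0E.
by rewrite mulrDr.
Unshelve. all: by end_near. Qed.

Let scaleL0Dl f : {morph scaleL0^~ f : a b / a + b}.
Proof.
move=> a b; apply/L0P; near=> x.
have -> : scaleL0 (a + b) f x = (a + b) * f x by near: x; exact: scaleL0E.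
have -> : (scaleL0 a f + scaleL0 b f : L0) x = scaleL0 a f x + scaleL0 b f x.
  by near: x; exact: addL0E.
have -> : scaleL0 a f x = a * f x by near: x; exact: scaleL0E.
have -> : scaleL0 b f x = b * f x by near: x; exact: scaleL0E.
by rewrite mulrDl.
Unshelve. all: by end_near. Qed.

HB.instance Definition _ := GRing.Zmodule_isLmodule.Build R L0
  scaleL0A scale1L0 scaleL0Dr scaleL0Dl.

Lemma L0D (f g : L0) : \forall x \ae mu, (f + g : L0) x = f x + g x.
Proof. exact: addL0E. Qed.

Lemma L0Z a (f : L0) : \forall x \ae mu, (a *: f : L0) x = a * f x.
Proof. exact: scaleL0E. Qed.

Lemma L00 : \forall x \ae mu, (0 : L0) x = 0.
Proof. exact: zeroL0E. Qed.

End L0.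

(* The ideal property of Banach function spaces, without completeness. *)
Record ideal_space d (T : measurableType d) (R : realType)
    (mu : {measure set T -> \bar R}) := IdealSpace {
  ideal_base :> normed_subspace (L0 mu) ;
  idealP : forall f g : L0 mu, carrier ideal_base g ->
    (\forall x \ae mu, `|f x| <= `|g x|) ->
    carrier ideal_base f /\ fnorm ideal_base f <= fnorm ideal_base g
}.

Lemma fnorm0 (R : realType) (V : lmodType R) (A : normed_subspace V) :
  fnorm A 0 = 0.
Proof. by rewrite -(scale0r 0) fnormZ ?normr0 ?mul0r//; exact: carrier0. Qed.

Lemma fnorm_ge0 (R : realType) (V : lmodType R) (A : normed_subspace V) f :
  carrier A f -> 0 <= fnorm A f.
Proof.
move=> Af; have Nf : carrier A (-1 *: f) by exact: carrierZ.
have := fnormD Af Nf.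
by rewrite scaleN1r subrr fnorm0 -scaleN1r fnormZ// normrN1 mul1r -mulr2n pmulrn_lge0.
Qed.

(* absop f stands for T|f|, with values in [0, +oo] a.e.  The laws are what
   makes f |-> || T|f| ||_X a norm for every ideal_space X. *)
Record abs_operator d (T : measurableType d) (R : realType)
    (mu : {measure set T -> \bar R}) := AbsOperator {
  absop :> (T -> R) -> T -> \bar R ;
  measurable_absop : forall f : T -> R, measurable_fun setT f ->
    measurable_fun setT (absop f) ;
  absop_ge0 : forall f : T -> R, measurable_fun setT f ->
    \forall x \ae mu, (0 <= absop f x)%E ;
  absop_le : forall (a b : R) (f g h : T -> R), 0 <= a -> 0 <= b ->
    measurable_fun setT f -> measurable_fun setT g -> measurable_fun setT h ->
    (\forall x \ae mu, `|h x| <= a * `|f x| + b * `|g x|) ->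
    \forall x \ae mu, (absop h x <= a%:E * absop f x + b%:E * absop g x)%E ;
  absop_eq0 : forall f : T -> R, measurable_fun setT f ->
    (\forall x \ae mu, absop f x = 0%E) -> \forall x \ae mu, f x = 0
}.

Section Derived.
Context d (T : measurableType d) (R : realType).
Variables (mu : {measure set T -> \bar R}) (X : ideal_space mu).
Variable op : abs_operator mu.

(* X consists of real-valued classes, so "T|f| belongs to X" means that the
   extended real function T|f| is a.e. equal to some g in X; such a g is
   unique (represents_inj), and the norm of f is the norm of g in X
   (derived_fnormE). *)
Definition represents (h : T -> \bar R) (g : L0 mu) : Prop :=
  \forall x \ae mu, h x = (g x)%:E.

Definition derived_carrier : set (L0 mu) :=
  [set f | exists2 g, represents (op f) g & carrier X g].

Definition derived_fnorm (f : L0 mu) : R :=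
  fnorm X (xget 0 [set g | represents (op f) g]).

Lemma represents_inj h g1 g2 : represents h g1 -> represents h g2 -> g1 = g2.
Proof.
move=> h1 h2; apply/L0P; near=> x; apply: EFin_inj.
have <- : h x = (g1 x)%:E by near: x; exact: h1.
by near: x; exact: h2.
Unshelve. all: by end_near. Qed.

Lemma derived_fnormE (f g : L0 mu) :
  represents (op f) g -> derived_fnorm f = fnorm X g.
Proof.
move=> fg; rewrite /derived_fnorm; congr fnorm.
case: xgetP => [h _ fh|/(_ g)//].
exact: represents_inj fh fg.
Qed.

Lemma derived_le (a b : R) (f g h u v : L0 mu) : 0 <= a -> 0 <= b ->
  (\forall x \ae mu, `|h x| <= a * `|f x| + b * `|g x|) ->
  represents (op f) u -> carrier X u -> represents (op g) v -> carrier X v ->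
  exists w, [/\ represents (op h) w, carrier X w &
    fnorm X w <= a * fnorm X u + b * fnorm X v].
Proof.
move=> a0 b0 hfg fu Xu gv Xv.
have mf := measurable_L0 f; have mg := measurable_L0 g.
have mh := measurable_L0 h.
have oph := absop_le op a0 b0 mf mg mh hfg.
have moph : measurable_fun setT (fine \o op h).
  by apply: measurableT_comp => //; exact: measurable_absop.
pose w' : {mfun T >-> R} := HB.pack (fine \o op h)
  (isMeasurableFun.Build _ _ _ _ (fine \o op h) moph).
pose w : L0 mu := classL0 mu w'.
pose s : L0 mu := a *: u + b *: v.
have hs : \forall x \ae mu, s x = a * u x + b * v x.
  near=> x.
  have -> : s x = (a *: u : L0 mu) x + (b *: v : L0 mu) x by near: x; exact: L0D.
  have -> : (a *: u : L0 mu) x = a * u x by near: x; exact: L0Z.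
  by have -> : (b *: v : L0 mu) x = b * v x by near: x; exact: L0Z.
have hle : \forall x \ae mu, (0 <= op h x <= (s x)%:E)%E.
  near=> x; apply/andP; split.
    by near: x; exact: absop_ge0.
  have -> : s x = a * u x + b * v x by near: x; exact: hs.
  rewrite EFinD !EFinM.
  have <- : op f x = (u x)%:E by near: x; exact: fu.
  have <- : op g x = (v x)%:E by near: x; exact: gv.
  by near: x; exact: oph.
have hw : represents (op h) w.
  rewrite /represents; near=> x.
  have -> : w x = fine (op h x) by near: x; exact: classL0E.
  rewrite fineK//.
  have /andP[p0 ps] : (0 <= op h x <= (s x)%:E)%E by near: x; exact: hle.
  by rewrite ge0_fin_numE// (le_lt_trans ps)// ltry.
have Xau : carrier X (a *: u) by exact: carrierZ.
have Xbv : carrier X (b *: v) by exact: carrierZ.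
have [||Xw gw] := @idealP _ _ _ _ X w s.
- exact: carrierD.
- near=> x.
  have /andP[] : (0 <= op h x <= (s x)%:E)%E by near: x; exact: hle.
  have -> : op h x = (w x)%:E by near: x; exact: hw.
  rewrite !lee_fin => w0 ws.
  by rewrite !ger0_norm// (le_trans w0).
exists w; split => //; rewrite (le_trans gw)// (le_trans (fnormD _ _))//.
by rewrite !fnormZ// !ger0_norm.
Unshelve. all: by end_near. Qed.

Let derived0 : derived_carrier 0.
Proof.
exists 0; last exact: carrier0.
set z : L0 mu := 0.
have z0 : \forall x \ae mu, z x = 0 by exact: L00.
have mz := measurable_L0 z.
have opz : \forall x \ae mu, (op z x <= 0%:E * op z x + 0%:E * op z x)%E.
  apply: absop_le => //; apply: filterS z0 => x ->.
  by rewrite normr0 mul0r addr0.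
have opz0 : \forall x \ae mu, (0 <= op z x)%E by exact: absop_ge0.
rewrite /represents; near=> x.
have -> : z x = 0 by near: x; exact: z0.
apply/eqP; rewrite eq_le; apply/andP; split; last by near: x; exact: opz0.
have : (op z x <= 0%:E * op z x + 0%:E * op z x)%E by near: x; exact: opz.
by rewrite mul0e adde0.
Unshelve. all: by end_near. Qed.

Let derivedD_aux f g : derived_carrier f -> derived_carrier g ->
  derived_carrier (f + g) /\
  derived_fnorm (f + g) <= derived_fnorm f + derived_fnorm g.
Proof.
move=> [u fu Xu] [v gv Xv].
have [|w [fgw Xw lew]] := @derived_le 1 1 f g (f + g) u v ler01 ler01 _ fu Xu gv Xv.
  near=> x.
  have -> : (f + g : L0 mu) x = f x + g x by near: x; exact: L0D.
  by rewrite !mul1r ler_normD.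
split; first by exists w.
by rewrite (derived_fnormE fu) (derived_fnormE gv) (derived_fnormE fgw)
  (le_trans lew)// !mul1r.
Unshelve. all: by end_near. Qed.

Let derivedD f g : derived_carrier f -> derived_carrier g ->
  derived_carrier (f + g).
Proof. by move=> df dg; case: (derivedD_aux df dg). Qed.

Let derived_fnormD f g : derived_carrier f -> derived_carrier g ->
  derived_fnorm (f + g) <= derived_fnorm f + derived_fnorm g.
Proof. by move=> df dg; case: (derivedD_aux df dg). Qed.

Let derivedZ_aux a f : derived_carrier f ->
  derived_carrier (a *: f) /\ derived_fnorm (a *: f) <= `|a| * derived_fnorm f.
Proof.
move=> [u fu Xu].
have [|w [afw Xw lew]] :=
    @derived_le `|a| 0 f f (a *: f) u u (normr_ge0 a) (lexx 0) _ fu Xu fu Xu.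
  near=> x.
  have -> : (a *: f : L0 mu) x = a * f x by near: x; exact: L0Z.
  by rewrite mul0r addr0 normrM.
split; first by exists w.
by rewrite (derived_fnormE fu) (derived_fnormE afw) (le_trans lew)// mul0r addr0.
Unshelve. all: by end_near. Qed.

Let derivedZ a f : derived_carrier f -> derived_carrier (a *: f).
Proof. by move=> df; case: (derivedZ_aux a df). Qed.

Let derived_fnormZ a f : derived_carrier f ->
  derived_fnorm (a *: f) = `|a| * derived_fnorm f.
Proof.
move=> df; apply/eqP; rewrite eq_le (derivedZ_aux a df).2/=.
have [->|a0] := eqVneq a 0.
  rewrite normr0 mul0r scale0r; case: derived0 => u u0 Xu.
  by rewrite (derived_fnormE u0) fnorm_ge0.
have := (derivedZ_aux a^-1 (derivedZ a df)).2.
by rewrite scalerA mulVf// scale1r normfV ler_pdivlMl// normr_gt0.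
Qed.

Let derived_fnorm_eq0 f : derived_carrier f -> derived_fnorm f = 0 -> f = 0.
Proof.
move=> [u fu Xu]; rewrite (derived_fnormE fu) => /(fnorm_eq0 Xu) u0.
apply/L0P.
have f0 : \forall x \ae mu, f x = 0.
  apply: (absop_eq0 (measurable_L0 f) (_ : \forall x \ae mu, op f x = 0%E)).
  near=> x.
  have -> : op f x = (u x)%:E by near: x; exact: fu.
  by rewrite u0; congr EFin; near: x; exact: L00.
near=> x.
have -> : f x = 0 by near: x; exact: f0.
by apply/esym; near: x; exact: L00.
Unshelve. all: by end_near. Qed.

Definition derived : normed_subspace (L0 mu) :=
  NormedSubspace derived0 derivedD derivedZ
    derived_fnormD derived_fnormZ derived_fnorm_eq0.

End Derived.
Arguments represents {d T R} mu h g.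

Section Lebesgue.
Context d (T : measurableType d) (R : realType).
Variables (mu : {measure set T -> \bar R}) (p : \bar R).
Hypothesis p1 : (1 <= p)%E.

Definition Lp_carrier : set (L0 mu) := [set f : L0 mu | finite_norm mu p (f : T -> R)].

Definition Lp_fnorm (f : L0 mu) : R := fine ('N[mu]_p[EFin \o (f : T -> R)])%E.

Lemma le_Lnorm (f g : T -> R) :
  measurable_fun setT f -> measurable_fun setT g ->
  (\forall x \ae mu, `|f x| <= `|g x|) ->
  ('N[mu]_p[EFin \o f] <= 'N[mu]_p[EFin \o g])%E.
Proof.
move=> mf mg fg; rewrite unlock /Lnorm; case: p p1 => [r|_|//].
- rewrite lee_fin => r1; have r0 : 0 <= r by rewrite (le_trans _ r1).
  have h (k : T -> R) : measurable_fun setT k ->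
      measurable_fun setT (fun x => `|(EFin \o k) x| `^ r)%E.
    move=> mk; apply: (@measurableT_comp _ _ _ _ _ _ (fun x => x `^ r)%E) => /=.
      exact: measurable_poweR.
    by apply: measurableT_comp => //; apply: measurableT_comp.
  apply: gt0_ler_poweR.
  + by rewrite invr_ge0.
  + by rewrite in_itv/= leey integral_ge0// => x _; exact: poweR_ge0.
  + by rewrite in_itv/= leey integral_ge0// => x _; exact: poweR_ge0.
  apply: ae_ge0_le_integral => //.
  + by move=> x _; exact: poweR_ge0.
  + exact: h.
  + by move=> x _; exact: poweR_ge0.
  + exact: h.
  apply: filterS fg => x fgx _ /=.
  by rewrite lee_fin ge0_ler_powR// nnegrE.
- by case: ifPn => // _; apply: le_ess_sup; apply: filterS fg => x /=.
Qed.

Let finLnorm (f : L0 mu) : Lp_carrier f ->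
  ('N[mu]_p[EFin \o f])%E = (Lp_fnorm f)%:E.
Proof. by move=> ff; rewrite /Lp_fnorm fineK// ge0_fin_numE// Lnorm_ge0. Qed.

Let p0 : (0 < p)%E.
Proof. by rewrite (lt_le_trans _ p1). Qed.

Let eqLp (f : L0 mu) (g : T -> R) : measurable_fun setT g ->
  (\forall x \ae mu, f x = g x) ->
  'N[mu]_p[EFin \o f]%E = 'N[mu]_p[EFin \o g]%E.
Proof.
move=> mg fg; have mf := measurable_L0 f.
by apply/eqP; rewrite eq_le !le_Lnorm//; apply: filterS fg => x ->.
Qed.

Let Lp0 : Lp_carrier 0.
Proof.
rewrite /Lp_carrier/= /finite_norm (@eqLp _ (cst 0))//; last exact: L00.
by rewrite Lnorm0// gt_eqF.
Qed.

Let LpD_aux (f g : L0 mu) : Lp_carrier f -> Lp_carrier g ->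
  ('N[mu]_p[EFin \o ((f + g)%R : L0 mu)] <= (Lp_fnorm f + Lp_fnorm g)%:E)%E.
Proof.
move=> ff gf; have mf := measurable_L0 f; have mg := measurable_L0 g.
rewrite (@eqLp _ (f \+ g)); last exact: L0D.
  by rewrite EFinD -!finLnorm// eminkowski.
exact: measurable_funD.
Qed.

Let LpD (f g : L0 mu) : Lp_carrier f -> Lp_carrier g -> Lp_carrier (f + g).
Proof. by move=> ff gf; exact: le_lt_trans (LpD_aux ff gf) (ltry _). Qed.

Let Lp_fnormD (f g : L0 mu) : Lp_carrier f -> Lp_carrier g ->
  Lp_fnorm (f + g) <= Lp_fnorm f + Lp_fnorm g.
Proof. by move=> ff gf; rewrite -lee_fin -finLnorm ?LpD_aux//; exact: LpD. Qed.

Let LpZ_aux a (f : L0 mu) : Lp_carrier f ->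
  ('N[mu]_p[EFin \o ((a *: f)%R : L0 mu)] = (`|a| * Lp_fnorm f)%:E)%E.
Proof.
move=> ff; have mf := measurable_L0 f.
rewrite (@eqLp _ (a \*: (f : T -> R))); [|exact: measurable_funM|exact: L0Z].
rewrite EFinM -finLnorm//.
have fP : (f : T -> R) \in Lfun mu p.
  by rewrite inE; apply/andP; split; rewrite inE.
exact: (LnormZ (Lfun_Sub p1 fP) a).
Qed.

Let LpZ a (f : L0 mu) : Lp_carrier f -> Lp_carrier (a *: f).
Proof. by move=> ff; rewrite /Lp_carrier/= /finite_norm LpZ_aux// ltry. Qed.

Let Lp_fnormZ a (f : L0 mu) : Lp_carrier f ->
  Lp_fnorm (a *: f) = `|a| * Lp_fnorm f.
Proof. by move=> ff; apply: EFin_inj; rewrite -finLnorm ?LpZ_aux//; exact: LpZ. Qed.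

Let Lp_fnorm_eq0 (f : L0 mu) : Lp_carrier f -> Lp_fnorm f = 0 -> f = 0.
Proof.
move=> ff f0; apply/L0P.
have : (EFin \o f = \0 %[ae mu])%E.
  apply: (@Lnorm_eq0_eq0 _ _ _ _ _ p) => //; last by rewrite finLnorm// f0.
  by apply/measurable_EFinP; exact: measurable_L0.
move=> f0'; near=> x.
have -> : (0 : L0 mu) x = 0 by near: x; exact: L00.
have : setT x -> (f x)%:E = 0%E by near: x; exact: f0'.
by move=> /(_ I)[].
Unshelve. all: by end_near. Qed.

Definition Lp_normed : normed_subspace (L0 mu) :=
  NormedSubspace Lp0 LpD LpZ Lp_fnormD Lp_fnormZ Lp_fnorm_eq0.

Let Lp_ideal (f g : L0 mu) : Lp_carrier g ->
  (\forall x \ae mu, `|f x| <= `|g x|) ->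
  Lp_carrier f /\ Lp_fnorm f <= Lp_fnorm g.
Proof.
move=> gf fg.
have le : ('N[mu]_p[EFin \o f] <= 'N[mu]_p[EFin \o g])%E.
  by apply: le_Lnorm => //; exact: measurable_L0.
have ff : Lp_carrier f by exact: le_lt_trans le gf.
by split=> //; rewrite -lee_fin -!finLnorm.
Qed.

Definition Lp : ideal_space mu := @IdealSpace _ _ _ mu Lp_normed Lp_ideal.

End Lebesgue.

Variant base_itv := UnitItv | HalfLine.

Section Domain.
Context {R : realType}.
Implicit Type I : base_itv.

Local Notation leb := (@lebesgue_measure R).
#[local] Hint Extern 0 (Filter (nbhs (almost_everywhere _))) =>
  (exact: (ae_filter_ringOfSetsType leb)) : typeclass_instances.

Definition itv_of I : interval R :=
  match I with UnitItv => `[0, 1] | HalfLine => `[0, +oo[ end.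

(* A class modulo lebesgue_on I ignores the values outside I, and every
   Lebesgue measurable function on I has a Borel representative, so
   L0 (lebesgue_on I) is L^0(I). *)
Definition lebesgue_on I : {measure set (measurableTypeR R) -> \bar R} :=
  mrestr leb (measurable_itv (itv_of I)).

Definition itv_tail I (x : R) : set R := [set` itv_of I] `&` `[x, +oo[.

Lemma measurable_itv_tail I x : measurable (itv_tail I x).
Proof. exact: measurableI. Qed.

(* Only 0 < x in I matters: {0} and the complement of I are lebesgue_on I
   negligible.  For such x, the interval [0, x] is contained in I. *)
Definition Cesaro (f : R -> R) (x : R) : \bar R :=
  ((x^-1)%:E * \int[leb]_(t in `[0%R, x]) (f t)%:E)%E.

Definition Copson I (f : R -> R) (x : R) : \bar R :=
  (\int[leb]_(t in itv_tail I x) (f t / t)%:E)%E.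

(* ess sup of |f t| over t in I, t >= x.  It is -oo when that set is
   negligible, which for x in I happens only at x = 1, I = [0, 1]. *)
Definition majorant I (f : R -> R) (x : R) : \bar R :=
  ess_sup (mrestr leb (measurable_itv_tail I x)) (fun t => (`|f t|)%:E).

Lemma ae_restr (D : set R) (mD : measurable D) (P : R -> Prop) :
  (\forall x \ae mrestr leb mD, P x) <-> (\forall x \ae leb, D x -> P x).
Proof.
split=> -[N [mN N0 PN]].
  exists (N `&` D); split => //; first exact: measurableI.
  by move=> x /= /not_implyP[Dx nP]; split => //; exact: PN.
exists (N `|` ~` D); split.
- by apply: measurableU => //; exact: measurableC.
- rewrite /= /mrestr setIUl setICl setU0.
  by apply: subset_measure0 N0 => //; exact: measurableI.
- move=> x /= nP; have [Dx|] := pselect (D x); last by right.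
  by left; apply: PN => /= /(_ Dx).
Qed.

Lemma itv_of_ge0 I x : [set` itv_of I] x -> 0 <= x.
Proof. by case: I; rewrite /= in_itv/= => /andP[]. Qed.

Lemma itv_of_sub I x y : 0 <= y <= x -> [set` itv_of I] x -> [set` itv_of I] y.
Proof.
case: I; rewrite /= !in_itv/= => /andP[-> yx] //= /andP[_ x1].
exact: le_trans x1.
Qed.

Lemma ae_neq (c : R) : \forall x \ae leb, x != c.
Proof.
exists [set c]; split; [exact: measurable_set1|exact: lebesgue_measure_set1|].
by move=> x /= /negP; rewrite negbK => /eqP.
Qed.

Lemma itv_of_room I t : [set` itv_of I] t -> t != 1 ->
  exists2 u, t < u & [set` itv_of I] u.
Proof.
case: I => /=; rewrite in_itv/= => /andP[t0].
- move=> t1 tn1; exists 1; first by rewrite lt_neqAle tn1.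
  by rewrite in_itv/= lexx ler01.
- by move=> _ _; exists (t + 1); rewrite ?ltrDl// in_itv/= andbT addr_ge0.
Qed.

Lemma ae_between I (P : R -> Prop) a b : 0 <= a -> a < b -> [set` itv_of I] b ->
  (\forall x \ae lebesgue_on I, P x) ->
  exists x, [/\ a < x, x < b, [set` itv_of I] x & P x].
Proof.
move=> a0 ab Ib /ae_restr [N [mN N0 PN]].
apply: contrapT => noP.
have : (leb `]a, b[%classic <= leb N)%E.
  apply: le_measure; rewrite ?inE//.
  move=> x /=; rewrite in_itv/= => /andP[ax xb]; apply: PN => /= Px; apply: noP.
  have Ix : [set` itv_of I] x.
    by apply: itv_of_sub Ib; rewrite (le_trans a0 (ltW ax)) ltW.
  by exists x; split => //; exact: Px.
rewrite N0 lebesgue_measure_itv/= lte_fin ab -EFinD lee_fin.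
by rewrite leNgt subr_gt0 ab.
Qed.

Lemma ae_rat (P : rat -> R -> Prop) :
  (forall q, \forall x \ae leb, P q x) -> \forall x \ae leb, forall q, P q x.
Proof.
move=> h; have := @ae_foralln _ _ _ leb (fun n => P (odflt 0 (unpickle n))) _.
move=> /(_ (fun n => h _)); apply: filterS => x + q => /(_ (pickle q)).
by rewrite pickleK.
Qed.

Lemma ae0_head I (f : R -> R) :
  (\forall x \ae lebesgue_on I, \forall t \ae leb, 0 <= t <= x -> f t = 0) ->
  \forall x \ae lebesgue_on I, f x = 0.
Proof.
move=> h; apply/ae_restr.
have hq (q : rat) : \forall t \ae leb,
    (exists x, [/\ ratr q < x, [set` itv_of I] x &
      \forall t \ae leb, 0 <= t <= x -> f t = 0]) ->
    0 <= t <= ratr q -> f t = 0.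
  have [[x [qx _ fx]]|no] := pselect (exists x, [/\ ratr q < x, [set` itv_of I] x &
      \forall t \ae leb, 0 <= t <= x -> f t = 0]); last first.
    by apply/nearW => t; move=> /no.
  apply: filterS fx => t ft _ /andP[t0 tq]; apply: ft.
  by rewrite t0 (le_trans tq)// ltW.
near=> t => It.
have t1 : t != 1 by near: t; exact: ae_neq.
have [u tu Iu] := itv_of_room It t1.
have t0 := itv_of_ge0 It.
have [x [tx _ Ix fx]] := ae_between t0 tu Iu h.
have [q] := rat_in_itvoo tx; rewrite in_itv/= => /andP[tq qx].
have hqt : forall q : rat, (exists x, [/\ ratr q < x, [set` itv_of I] x &
      \forall t \ae leb, 0 <= t <= x -> f t = 0]) ->
    0 <= t <= ratr q -> f t = 0 by near: t; exact: ae_rat.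
by apply: (hqt q); [exists x | rewrite t0 ltW].
Unshelve. all: by end_near. Qed.

Lemma ae0_tail I (f : R -> R) :
  (\forall x \ae lebesgue_on I, \forall t \ae leb, itv_tail I x t -> f t = 0) ->
  \forall x \ae lebesgue_on I, f x = 0.
Proof.
move=> h; apply/ae_restr.
have hq (q : rat) : \forall t \ae leb,
    (exists x, [/\ x < ratr q, [set` itv_of I] x &
      \forall t \ae leb, itv_tail I x t -> f t = 0]) ->
    itv_tail I (ratr q) t -> f t = 0.
  have [[x [xq _ fx]]|no] := pselect (exists x, [/\ x < ratr q, [set` itv_of I] x &
      \forall t \ae leb, itv_tail I x t -> f t = 0]); last first.
    by apply/nearW => t; move=> /no.
  apply: filterS fx => t ft _ [It]; rewrite /= in_itv/= andbT => qt; apply: ft.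
  by split => //=; rewrite in_itv/= andbT (le_trans _ qt)// ltW.
near=> t => It.
have t0 : 0 < t.
  by rewrite lt_neqAle (itv_of_ge0 It) eq_sym andbT; near: t; exact: ae_neq.
have [x [_ xt Ix fx]] := ae_between (lexx 0) t0 It h.
have [q] := rat_in_itvoo xt; rewrite in_itv/= => /andP[xq qt].
have hqt : forall q : rat, (exists x, [/\ x < ratr q, [set` itv_of I] x &
      \forall t \ae leb, itv_tail I x t -> f t = 0]) ->
    itv_tail I (ratr q) t -> f t = 0 by near: t; exact: ae_rat.
apply: (hqt q); first by exists x.
by split => //=; rewrite in_itv/= andbT ltW.
Unshelve. all: by end_near. Qed.

Lemma integral_le_lin (D : set R) (w f g h : R -> R) a b :
  measurable D -> measurable_fun setT w -> (forall t, D t -> 0 <= w t) ->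
  0 <= a -> 0 <= b -> measurable_fun setT f -> measurable_fun setT g ->
  measurable_fun setT h ->
  (\forall t \ae leb, D t -> `|h t| <= a * `|f t| + b * `|g t|) ->
  (\int[leb]_(t in D) (`|h t| * w t)%:E <=
   a%:E * \int[leb]_(t in D) (`|f t| * w t)%:E +
   b%:E * \int[leb]_(t in D) (`|g t| * w t)%:E)%E.
Proof.
move=> mD mw w0 a0 b0 mf mg mh hfg.
have mk (k : R -> R) : measurable_fun setT k ->
    measurable_fun D (fun t => (`|k t| * w t)%:E).
  move=> mk; apply: measurable_funTS; apply/measurable_EFinP.
  by apply: measurable_funM => //; exact: measurableT_comp.
have k0 (k : R -> R) t : D t -> (0 <= (`|k t| * w t)%:E)%E.
  by move=> Dt; rewrite lee_fin mulr_ge0// w0.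
rewrite -!ge0_integralZl_EFin//; [|exact: k0|exact: mk|exact: k0|exact: mk].
rewrite -ge0_integralD//; last 4 first.
- by move=> t Dt; rewrite mule_ge0// k0.
- by apply: emeasurable_funM => //; exact: mk.
- by move=> t Dt; rewrite mule_ge0// k0.
- by apply: emeasurable_funM => //; exact: mk.
apply: ae_ge0_le_integral => //.
- exact: k0.
- exact: mk.
- by move=> t Dt; rewrite adde_ge0// mule_ge0// k0.
- by apply: emeasurable_funD; apply: emeasurable_funM => //; exact: mk.
apply: filterS hfg => t ht Dt.
by rewrite -!EFinM -EFinD lee_fin !mulrA -mulrDl ler_wpM2r// ?w0// ht.
Qed.

Lemma integral_eq0_ae (D : set R) (w f : R -> R) :
  measurable D -> measurable_fun setT w ->
  (forall t, D t -> 0 <= w t) -> (\forall t \ae leb, D t -> w t != 0) ->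
  measurable_fun setT f -> (\int[leb]_(t in D) (`|f t| * w t)%:E = 0)%E ->
  \forall t \ae leb, D t -> f t = 0.
Proof.
move=> mD mw w0 wn0 mf fw0.
have : (\int[leb]_(t in D) `|(f t * w t)%:E| = 0)%E.
  rewrite -[RHS]fw0; apply: eq_integral => t; rewrite inE => Dt.
  by rewrite /= normrM (ger0_norm (w0 _ Dt)).
move/ae_eq_integral_abs => /(_ mD) => h.
have {}h : ae_eq leb D (fun t => (f t * w t)%:E) (cst 0%E).
  by apply: h; apply: measurable_funTS; apply/measurable_EFinP/measurable_funM.
near=> t => Dt.
have wt : D t -> w t != 0 by near: t.
have : D t -> (f t * w t)%:E = 0%E by near: t; exact: h.
by move=> /(_ Dt)[] /eqP; rewrite mulf_eq0 (negbTE (wt Dt)) orbF => /eqP.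
Unshelve. all: by end_near. Qed.

Lemma monotone_emeasurable (f : R -> \bar R) :
  {homo f : x y / x <= y >-> (x <= y)%E} \/
  {homo f : x y / x <= y >-> (y <= x)%E} -> measurable_fun setT f.
Proof.
move=> mf; apply: (measurability _ (ErealGenCInfty.measurableE R)) => //.
move=> _ [_ [r ->] <-]; apply: measurableI => //.
apply: is_interval_measurable => s t /=; rewrite !in_itv/= !andbT => fs ft u.
move=> /andP[su ut]; rewrite in_itv/= andbT; case: mf => mf.
- exact: le_trans (mf _ _ su).
- exact: le_trans (mf _ _ ut).
Qed.

Lemma measurable_invr : measurable_fun setT (fun x : R => x^-1).
Proof.
rewrite -(setUv [set (0 : R)]).
apply/measurable_funU; [exact: measurable_set1|exact: measurableC|split].
  exact: measurable_fun_set1.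
apply: open_continuous_measurable_fun.
  by rewrite openC; exact: closed_eq.
by move=> x; rewrite inE/= => /eqP x0; exact: inv_continuous.
Qed.

End Domain.

Section Operators.
Context {R : realType}.
Implicit Types (I : base_itv) (f g h : R -> R).

Local Notation leb := (@lebesgue_measure R).
#[local] Hint Extern 0 (Filter (nbhs (almost_everywhere _))) =>
  (exact: (ae_filter_ringOfSetsType leb)) : typeclass_instances.
Let filterS_on I (P Q : R -> Prop) : (forall x, P x -> Q x) ->
  (\forall x \ae lebesgue_on I, P x) -> \forall x \ae lebesgue_on I, Q x.
Proof. exact: (@filterS _ _ (ae_filter_ringOfSetsType (lebesgue_on I))). Qed.

Let normfun f : R -> R := fun t => `|f t|.

Let cesaro1 f (x : R) : Cesaro (normfun f) x =
  ((x^-1)%:E * \int[leb]_(t in `[0%R, x]) (`|f t| * cst 1 t)%:E)%E.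
Proof. by rewrite /Cesaro; under [in RHS]eq_integral do rewrite mulr1. Qed.

Section CesaroOperator.
Variable I : base_itv.

Let measurable_cesaro f : measurable_fun setT f ->
  measurable_fun setT (Cesaro (normfun f)).
Proof.
move=> mf; apply: emeasurable_funM.
  apply/measurable_EFinP; exact: measurable_invr.
apply: monotone_emeasurable; left => x y xy.
apply: ge0_subset_integral => //.
- by apply: measurable_funTS; apply/measurable_EFinP; exact: measurableT_comp.
- by move=> t _; rewrite lee_fin /normfun.
- by move=> t /=; rewrite !in_itv/= => /andP[-> /le_trans->].
Qed.

Let cesaro_ge0 f : measurable_fun setT f ->
  \forall x \ae lebesgue_on I, (0 <= Cesaro (normfun f) x)%E.
Proof.
move=> mf; apply/ae_restr/nearW => x /itv_of_ge0 x0.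
apply: mule_ge0; first by rewrite lee_fin invr_ge0.
by apply: integral_ge0 => t _; rewrite lee_fin /normfun.
Qed.

Let cesaro_le a b f g h : 0 <= a -> 0 <= b ->
  measurable_fun setT f -> measurable_fun setT g -> measurable_fun setT h ->
  (\forall x \ae lebesgue_on I, `|h x| <= a * `|f x| + b * `|g x|) ->
  \forall x \ae lebesgue_on I, (Cesaro (normfun h) x <=
    a%:E * Cesaro (normfun f) x + b%:E * Cesaro (normfun g) x)%E.
Proof.
move=> a0 b0 mf mg mh /ae_restr hfg; apply/ae_restr/nearW => x Ix.
have x0 := itv_of_ge0 Ix.
have i0 k : (0 <= \int[leb]_(t in `[0%R, x]) (`|k t| * cst 1 t)%:E)%E.
  by apply: integral_ge0 => t _; rewrite lee_fin mulr_ge0.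
rewrite !cesaro1 (muleCA a%:E) (muleCA b%:E) -ge0_muleDr ?mule_ge0//.
apply: lee_wpmul2l; first by rewrite lee_fin invr_ge0.
apply: integral_le_lin => //.
apply: filterS hfg => t ht /=; rewrite in_itv/= => t0x; apply: ht.
exact: itv_of_sub Ix.
Qed.

Let cesaro_eq0 f : measurable_fun setT f ->
  (\forall x \ae lebesgue_on I, Cesaro (normfun f) x = 0%E) ->
  \forall x \ae lebesgue_on I, f x = 0.
Proof.
move=> mf /ae_restr f0; apply: ae0_head; apply/ae_restr; near=> x => Ix.
have x0 : x != 0 by near: x; exact: ae_neq.
have : [set` itv_of I] x -> Cesaro (normfun f) x = 0%E by near: x.
move=> /(_ Ix); rewrite cesaro1 => /eqP; rewrite mule_eq0 eqe invr_eq0.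
rewrite (negbTE x0)/= => /eqP f00.
have /(_ _ _ _ _ mf f00) h := @integral_eq0_ae R `[0, x] (cst 1) f.
have {}h : \forall t \ae leb, `[0, x]%classic t -> f t = 0.
  by apply: h => //; apply: nearW => t _; exact: oner_neq0.
by apply: filterS h => t; rewrite /= in_itv.
Unshelve. all: by end_near. Qed.

Definition cesaro_operator : abs_operator (@lebesgue_on R I) :=
  @AbsOperator _ _ _ (lebesgue_on I) (fun f => Cesaro (fun t => `|f t|))
    measurable_cesaro cesaro_ge0 cesaro_le cesaro_eq0.

End CesaroOperator.

Section CopsonOperator.
Variable I : base_itv.

Let tailV_ge0 (x t : R) : itv_tail I x t -> 0 <= t^-1.
Proof. by move=> [/itv_of_ge0 t0 _]; rewrite invr_ge0. Qed.

Let measurable_copson f : measurable_fun setT f ->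
  measurable_fun setT (Copson I (normfun f)).
Proof.
move=> mf; apply: monotone_emeasurable; right => x y xy.
apply: ge0_subset_integral => //.
- exact: measurable_itv_tail.
- exact: measurable_itv_tail.
- apply: measurable_funTS; apply/measurable_EFinP; apply: measurable_funM.
    exact: measurableT_comp.
  exact: measurable_invr.
- by move=> t /tailV_ge0 t0; rewrite lee_fin mulr_ge0 /normfun.
- move=> t [It]; rewrite /= in_itv/= andbT => yt; split => //=.
  by rewrite in_itv/= andbT (le_trans xy).
Qed.

Let copson_ge0 f : measurable_fun setT f ->
  \forall x \ae lebesgue_on I, (0 <= Copson I (normfun f) x)%E.
Proof.
move=> mf; apply: nearW => x; apply: integral_ge0 => t /tailV_ge0 t0.
by rewrite lee_fin mulr_ge0 /normfun.
Qed.

Let copson_le a b f g h : 0 <= a -> 0 <= b ->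
  measurable_fun setT f -> measurable_fun setT g -> measurable_fun setT h ->
  (\forall x \ae lebesgue_on I, `|h x| <= a * `|f x| + b * `|g x|) ->
  \forall x \ae lebesgue_on I, (Copson I (normfun h) x <=
    a%:E * Copson I (normfun f) x + b%:E * Copson I (normfun g) x)%E.
Proof.
move=> a0 b0 mf mg mh /ae_restr hfg; apply: nearW => x.
apply: integral_le_lin => //.
- exact: measurable_itv_tail.
- exact: measurable_invr.
- exact: tailV_ge0.
by apply: filterS hfg => t ht [It _]; exact: ht.
Qed.

Let copson_eq0 f : measurable_fun setT f ->
  (\forall x \ae lebesgue_on I, Copson I (normfun f) x = 0%E) ->
  \forall x \ae lebesgue_on I, f x = 0.
Proof.
move=> mf f0; apply: ae0_tail; apply: (filterS_on _ f0) => x fx.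
apply: (@integral_eq0_ae R (itv_tail I x) (fun t => t^-1)) => //.
- exact: measurable_itv_tail.
- exact: measurable_invr.
- exact: tailV_ge0.
- near=> t => _; rewrite invr_eq0; near: t; exact: ae_neq.
Unshelve. all: by end_near. Qed.

Definition copson_operator : abs_operator (@lebesgue_on R I) :=
  @AbsOperator _ _ _ (lebesgue_on I) (fun f => Copson I (fun t => `|f t|))
    measurable_copson copson_ge0 copson_le copson_eq0.

End CopsonOperator.

Section MajorantOperator.
Variable I : base_itv.

Let tail_gt0 : \forall x \ae lebesgue_on I, (0 < leb (itv_tail I x))%E.
Proof.
apply/ae_restr; near=> x => Ix.
have x1 : x != 1 by near: x; exact: ae_neq.
have [u xu Iu] := itv_of_room Ix x1.
have : (leb `]x, u[%classic <= leb (itv_tail I x))%E.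
  apply: le_measure; rewrite ?inE//; first exact: measurable_itv_tail.
  move=> t /=; rewrite in_itv/= => /andP[xt tu]; split.
    by apply: itv_of_sub Iu; rewrite (le_trans (itv_of_ge0 Ix) (ltW xt)) ltW.
  by rewrite /= in_itv/= andbT ltW.
apply: lt_le_trans.
by rewrite lebesgue_measure_itv/= lte_fin xu -EFinD lte_fin subr_gt0.
Unshelve. all: by end_near. Qed.

Let measurable_majorant f : measurable_fun setT f ->
  measurable_fun setT (majorant I f).
Proof.
move=> mf; apply: monotone_emeasurable; right => x y xy.
apply/ess_supP; apply/ae_restr.
have /ae_restr := ess_sup_ge (mrestr leb (measurable_itv_tail I x))
  (fun t => (`|f t|)%:E).
apply: filterS => t ht [It]; rewrite /= in_itv/= andbT => yt; apply: ht.
by split=> //=; rewrite in_itv/= andbT (le_trans xy).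
Qed.

Let majorant_ge0 f : measurable_fun setT f ->
  \forall x \ae lebesgue_on I, (0 <= majorant I f x)%E.
Proof.
move=> mf; apply: (filterS_on _ tail_gt0) => x tx.
apply: ess_sup_gee; last by apply: nearW => t; rewrite lee_fin.
by rewrite /= /mrestr setTI.
Qed.

Let majorant_le a b f g h : 0 <= a -> 0 <= b ->
  measurable_fun setT f -> measurable_fun setT g -> measurable_fun setT h ->
  (\forall x \ae lebesgue_on I, `|h x| <= a * `|f x| + b * `|g x|) ->
  \forall x \ae lebesgue_on I, (majorant I h x <=
    a%:E * majorant I f x + b%:E * majorant I g x)%E.
Proof.
move=> a0 b0 mf mg mh /ae_restr hfg; apply: (filterS_on _ tail_gt0) => x tx.
have t0 : (0 < mrestr leb (measurable_itv_tail I x) setT)%E.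
  by rewrite /= /mrestr setTI.
rewrite /majorant -!ess_supZl//; apply: le_trans (ess_supD _ _ _).
apply: le_ess_sup; apply/ae_restr; apply: filterS hfg => t ht [It _].
by rewrite /= -!EFinM -EFinD lee_fin ht.
Qed.

Let majorant_eq0 f : measurable_fun setT f ->
  (\forall x \ae lebesgue_on I, majorant I f x = 0%E) ->
  \forall x \ae lebesgue_on I, f x = 0.
Proof.
move=> mf f0; apply: ae0_tail; apply: (filterS_on _ f0) => x fx.
have /ess_supP/ae_restr : (majorant I f x <= 0)%E by rewrite fx.
by apply: filterS => t ft /ft; rewrite lee_fin normr_le0 => /eqP.
Qed.

Definition majorant_operator : abs_operator (@lebesgue_on R I) :=
  @AbsOperator _ _ _ (lebesgue_on I) (majorant I)
    measurable_majorant majorant_ge0 majorant_le majorant_eq0.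

End MajorantOperator.

End Operators.

Section BanachFunctionSpaces.
Context (R : realType) (I : base_itv).

Record banach_function_space := BanachFunctionSpace {
  bfs_ideal :> ideal_space (@lebesgue_on R I) ;
  bfs_complete : forall F : set_system (fspace bfs_ideal),
    ProperFilter F -> cauchy F -> cvg F ;
  bfs_pos : exists2 g : L0 (lebesgue_on I), carrier bfs_ideal g &
    \forall x \ae lebesgue_on I, 0 < g x
}.

Definition CesaroSpace (X : ideal_space (@lebesgue_on R I)) :=
  derived X (cesaro_operator I).

Definition CopsonSpace (X : ideal_space (@lebesgue_on R I)) :=
  derived X (copson_operator I).

Definition TandoriSpace (X : ideal_space (@lebesgue_on R I)) :=
  derived X (majorant_operator I).

Definition Ces (p : \bar R) (p1 : (1 <= p)%E) : normedModType R :=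
  fspace (CesaroSpace (Lp (lebesgue_on I) p1)).

Definition Cop (p : \bar R) (p1 : (1 <= p)%E) : normedModType R :=
  fspace (CopsonSpace (Lp (lebesgue_on I) p1)).

Definition Ces_1 : normedModType R := Ces (lexx 1%E).
Definition Ces_oo : normedModType R := Ces (leey 1%E).
Definition Cop_1 : normedModType R := Cop (lexx 1%E).
Definition Cop_oo : normedModType R := Cop (leey 1%E).

End BanachFunctionSpaces.

(* Main.v *)
From HB Require Import structures.
Require Import Defs.
From mathcomp Require Import all_boot all_order all_algebra.
From mathcomp Require Import all_classical all_reals all_analysis.
From mathcomp Require Import measurable_realfun ess_sup_inf.
From mathcomp Require Import ring lra zify.

Set Implicit Arguments.
Unset Strict Implicit.
Unset Printing Implicit Defensive.

Import Order.TTheory GRing.Theory Num.Theory.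
Import numFieldNormedType.Exports.
Local Open Scope classical_set_scope.
Local Open Scope ring_scope.

(** Every space of the statement contains the fixed-point-free example of
    Alspach in L^1[0, 1]: there is a weakly compact convex set of functions
    0 <= f <= 2 of mean 1, and a nonexpansive map of that set into itself,
    whose fixed points would have to take the values 0 and 2 only and, at the
    same time, to be constant.

    The example is transported in a form that needs no L^1 space at all.  A
    function 0 <= f <= 2 is given by its averages over dyadic intervals, that
    is by a martingale on the binary tree, and the set of these martingales of
    mean 1 is compact for pointwise convergence.  If a normed space E contains
    a dyadic tree of vectors v_s (each v_s is the midpoint of its two children)
    such that the sums 2^-n sum_(|s| = n) f(s) v_s have norm
    2^-n sum_(|s| = n) |f(s)| and converge in E for every such martingale f,
    then the limits form a convex subset of E on which the map of Alspach acts
    nonexpansively without a fixed point.  That subset is weakly compact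
    because the limit depends continuously on f: a continuous linear functional
    phi turns the tree into the bounded martingale phi(v_s), which is Cauchy in
    L^1 since its increments are orthogonal in L^2, so phi of the limit is a
    uniform limit of functions of finitely many coordinates of f.  This is
    [dyadic_tree_not_wfpp].

    Two kinds of spaces contain such a tree.  In Ces_1[0, 1], Cop_1 and
    Cop_oo, the norm of a function g supported in [1/2, 1[ is an integral
    of |g| w with a positive weight w, by Tonelli's theorem for the first two
    and because the Copson transform is nonincreasing for the third; normalized
    indicators of dyadic intervals, divided by w, form the tree, and the limits
    exist because a bounded martingale has a density
    ([martingale_density], [weighted_L1_not_wfpp]).  In Ces_oo and in the
    Tandori spaces there are infinitely many disjoint blocks, accumulating at
    one point, such that a function constant on each block has norm
    (up to a common factor) equal to the supremum of its values whenever these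
    values recur infinitely often.  Such a space contains l^oo isometrically,
    and in l^oo the tree comes from testing a function on the dyadic steps
    against all sign patterns ([sup_norm_blocks_not_wfpp],
    [sup_norm_derived_not_wfpp]). *)

(** * Averages over the dyadic tree *)

Section Averages.
Context {R : realType}.
Implicit Types (f g : seq bool -> R) (n k : nat) (s t : seq bool).

(** A node of the binary tree is a path from the root written backwards: the
    children of s are false :: s and true :: s, the ancestor k generations up is
    drop k s, and rcons inserts a step at the root.  Reading f as the list of
    its values on the dyadic intervals of each length, iter n avg f s is the
    conditional expectation on the interval s of the level |s| + n of f. *)
Definition avg f s : R := (f (false :: s) + f (true :: s)) / 2.

Definition martingale f := avg f = f.

Lemma martingaleE f s : martingale f ->
  f s = (f (false :: s) + f (true :: s)) / 2.
Proof. by move=> {1}<-. Qed.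

Lemma ler_avgn n f g s :
  (forall t, f t <= g t) -> iter n avg f s <= iter n avg g s.
Proof.
move=> fg; elim: n s => [|n IH] s //=.
by rewrite /avg ler_pM2r// lerD.
Qed.

Lemma avgn_lin n a f g s :
  iter n avg (fun t => a * f t + g t) s = a * iter n avg f s + iter n avg g s.
Proof.
elim: n s => [|n IH] s //=; rewrite /avg !IH; lra.
Qed.

Lemma avgnB n f g s :
  iter n avg (fun t => f t - g t) s = iter n avg f s - iter n avg g s.
Proof. elim: n s => [|n IH] s //=; rewrite /avg !IH; lra. Qed.

Lemma avgnD n f g s :
  iter n avg (fun t => f t + g t) s = iter n avg f s + iter n avg g s.
Proof. elim: n s => [|n IH] s //=; rewrite /avg !IH; lra. Qed.

Lemma avgn_cst n c s : iter n avg (fun=> c) s = c.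
Proof. elim: n s => [|n IH] s //=; rewrite /avg !IH; lra. Qed.

Lemma avgn_ge0 n f s : (forall t, 0 <= f t) -> 0 <= iter n avg f s.
Proof. by move=> f0; rewrite -(avgn_cst n 0 s); exact: ler_avgn. Qed.

Lemma avgn_norm n f s :
  `|iter n avg f s| <= iter n avg (fun t => `|f t|) s.
Proof.
rewrite ler_norml; apply/andP; split; last exact/ler_avgn/(fun t => ler_norm _).
rewrite lerNl -[- _]add0r -(avgn_cst n 0 s) -avgnB.
by apply: ler_avgn => t; rewrite add0r -normrN ler_norm.
Qed.

Lemma martingale_avgn n f s : martingale f -> iter n avg f s = f s.
Proof. by move=> mf; rewrite iter_fix. Qed.

(** A factor that is already known at the node s comes out of the conditional
    expectation at s. *)
Lemma avgn_lift k f g s :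
  iter k avg (fun t => f t * g (drop k t)) s = iter k avg f s * g s.
Proof.
elim: k f s => [|k IH] f s; first by rewrite /= drop0.
rewrite !iterSr -IH; congr (iter k avg _ s); apply/funext => t.
by rewrite /avg /=; lra.
Qed.

Lemma avgn_rcons n f s b :
  iter n avg (fun t => f (rcons t b)) s = iter n avg f (rcons s b).
Proof. by elim: n s => [|n IH] s //=; rewrite /avg !IH. Qed.

Lemma avgnS_root n f : iter n.+1 avg f [::] =
  (iter n avg (fun t => f (rcons t false)) [::] +
   iter n avg (fun t => f (rcons t true)) [::]) / 2.
Proof. by rewrite !avgn_rcons. Qed.

(** |f| is a submartingale, so the L^1 norms of the levels increase. *)
Lemma avgn_norm_homo f s : martingale f ->
  {homo (fun n => iter n avg (fun t => `|f t|) s) : m n / (m <= n)%N >-> m <= n}.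
Proof.
move=> mf; apply: homo_leq => //; first exact: le_trans.
move=> n; rewrite iterSr; apply: ler_avgn => t.
by rewrite -{1}mf (avgn_norm 1).
Qed.

(** A single node of level n carries the fraction 2^-n of the total mass. *)
Lemma node_le_avgn f s : (forall t, 0 <= f t) ->
  f s <= 2 ^+ size s * iter (size s) avg f [::].
Proof.
elim: s f => [|b s IH] f f0; first by rewrite expr0 mul1r.
rewrite [size _]/= iterSr exprS.
have /IH : forall t, 0 <= avg f t by move=> t; exact: (avgn_ge0 1).
have -> : 2 * 2 ^+ size s * iter (size s) avg (avg f) [::] =
  2 * (2 ^+ size s * iter (size s) avg (avg f) [::]) by rewrite mulrA.
set z := _ * iter _ _ _ _; rewrite {1}/avg => h.
have := f0 (false :: s); have := f0 (true :: s); move: h.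
by case: b; lra.
Qed.

(** The L^2 norms of the levels of a bounded martingale increase and stay
    bounded, and by orthogonality the square of the L^2 distance of two levels
    is the difference of the squares of their norms; the L^1 distance is then
    small as well. *)
Lemma martingale_cauchy f C : martingale f -> (forall t, `|f t| <= C) ->
  forall e : R, 0 < e -> exists N, forall n k, (N <= n)%N ->
  iter (n + k) avg (fun t => `|f t - f (drop k t)|) [::] <= e.
Proof.
move=> mf fC e e0.
pose q n := iter n avg (fun t => f t ^+ 2) [::].
have sqE k s : iter k avg (fun t => (f t - f (drop k t)) ^+ 2) s =
    iter k avg (fun t => f t ^+ 2) s - f s ^+ 2.
  have -> : (fun t => (f t - f (drop k t)) ^+ 2) =
      (fun t => (- 2) * (f t * f (drop k t)) + (f t ^+ 2 + 1 * f (drop k t) ^+ 2)).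
    by apply/funext => t; ring.
  rewrite avgn_lin (avgn_lift k f f) avgnD.
  rewrite (avgn_lift k (fun=> 1) (fun t => f t ^+ 2)) avgn_cst martingale_avgn//.
  ring.
have q_sup : has_sup (range q).
  split; first by exists (q 0%N), 0%N.
  exists (C ^+ 2) => _ [n _ <-]; rewrite -(avgn_cst n (C ^+ 2) [::]).
  apply: ler_avgn => t; rewrite -real_normK ?num_real// lerXn2r// nnegrE//.
  exact: le_trans (fC [::]).
have qd n k : q (n + k)%N - q n =
    iter (n + k) avg (fun t => (f t - f (drop k t)) ^+ 2) [::].
  rewrite /q !iterD -avgnB; congr (iter n avg _ [::]).
  by apply/funext => s; rewrite sqE.
have qle n k : q n <= q (n + k)%N.
  by rewrite -subr_ge0 qd; apply: avgn_ge0 => t; exact: sqr_ge0.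
have [_ [N _ <-] qN] := sup_adherent (exprn_gt0 2 e0) q_sup.
exists N => n k Nn.
have : q (n + k)%N - q n <= e ^+ 2.
  have : q (n + k)%N <= sup (range q).
    by apply: ub_le_sup; [case: q_sup | exists (n + k)%N].
  have := qle N (n - N)%N; rewrite subnKC// => h1 h2.
  by move: qN h1 h2; lra.
rewrite qd => h.
(* |x| <= x^2 / (2 e) + e / 2 passes from the second to the first moment. *)
have -> : e = (2 * e)^-1 * e ^+ 2 + e / 2 by field; rewrite gt_eqF.
rewrite -[X in _ + X](avgn_cst (n + k) _ [::]).
apply: le_trans (_ : (2 * e)^-1 * iter (n + k) avg
   (fun t => (f t - f (drop k t)) ^+ 2) [::] +
   iter (n + k) avg (fun=> e / 2) [::] <= _); last first.
  by rewrite lerD2r ler_pM2l// invr_gt0 mulr_gt0.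
rewrite -avgn_lin; apply: ler_avgn => t.
rewrite -(@real_normK _ (f t - _)) ?num_real//; move: (`|_|) => x.
rewrite -subr_ge0.
have -> : (2 * e)^-1 * x ^+ 2 + e / 2 - x = (2 * e)^-1 * (x - e) ^+ 2.
  by field; rewrite gt_eqF.
by rewrite mulr_ge0 ?sqr_ge0// invr_ge0 mulr_ge0// ltW.
Qed.

End Averages.

(** * Alspach's map on bounded martingales *)

Section AlspachMap.
Context {R : realType}.
Implicit Types (f g : seq bool -> R) (n k : nat) (s t : seq bool).

(** The dyadic averages of the measurable functions on [0, 1] with values in
    [0, 2] and mean 1. *)
Definition alspach_set : set (seq bool -> R) :=
  [set f | [/\ martingale f, f [::] = 1 & forall s, 0 <= f s <= 2]].

(** The averages of min(f, 1) over the dyadic intervals: concavity of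
    u |-> min(u, 1) makes the approximations decrease with the level. *)
Definition cond_min1 f s : R :=
  limn (fun k => iter k avg (fun t => Num.min (f t) 1) s).

(** Alspach's map sends f to the function equal to min(2 f(2x), 2) on [0, 1/2]
    and to max(2 f(2x - 1) - 2, 0) on ]1/2, 1]; the first step of the path,
    which is the last letter, tells the halves apart.  In terms of averages
    this is 2 E(min(f, 1)) and 2 (f - E(min(f, 1))). *)
Definition alspach f s : R :=
  if s is b :: t then
    let r := belast b t in
    if last b t then 2 * (f r - cond_min1 f r) else 2 * cond_min1 f r
  else f [::].

Lemma alspach_rcons f s b : alspach f (rcons s b) =
  if b then 2 * (f s - cond_min1 f s) else 2 * cond_min1 f s.
Proof. by case: s => [|a s] //=; rewrite last_rcons belast_rcons. Qed.

Section OneMartingale.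
Variable f : seq bool -> R.
Hypothesis Pf : alspach_set f.

Let mf : martingale f. Proof. by case: Pf. Qed.

Let f02 s : 0 <= f s <= 2. Proof. by case: Pf. Qed.

Lemma cond_min1_nonincreasing s :
  nonincreasing_seq (fun k => iter k avg (fun t => Num.min (f t) 1) s).
Proof.
apply/nonincreasing_seqP => k; rewrite iterSr; apply: ler_avgn => t.
rewrite (martingaleE t mf) /avg; move: (f _) (f _) => x y.
have h (u : R) : Num.min u 1 <= u /\ Num.min u 1 <= 1.
  by rewrite !ge_min !lexx orbT.
by have [? ?] := h x; have [? ?] := h y; rewrite le_min; apply/andP; split; lra.
Qed.

Lemma cond_min1_cvg s :
  iter k avg (fun t => Num.min (f t) 1) s @[k --> \oo] --> cond_min1 f s.
Proof.
apply: nonincreasing_is_cvgn; first exact: cond_min1_nonincreasing.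
exists 0 => _ [k _ <-]; apply: avgn_ge0 => t.
by have /andP[ft _] := f02 t; rewrite le_min ft ler01.
Qed.

Lemma cond_min1_le k s : cond_min1 f s <= iter k avg (fun t => Num.min (f t) 1) s.
Proof.
apply: nonincreasing_cvgn_ge; first exact: cond_min1_nonincreasing.
by apply/cvg_ex; exists (cond_min1 f s); exact: cond_min1_cvg.
Qed.

Lemma cond_min1_ge g s : martingale g -> (forall t, g t <= Num.min (f t) 1) ->
  g s <= cond_min1 f s.
Proof.
move=> mg gf; apply: limr_ge.
  by apply/cvg_ex; exists (cond_min1 f s); exact: cond_min1_cvg.
by apply: nearW => k; rewrite -(martingale_avgn k s mg); exact: ler_avgn.
Qed.

Lemma cond_min1_martingale : martingale (cond_min1 f).
Proof.
apply/funext => s; apply/esym.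
have h := @cond_min1_cvg s; rewrite -cvg_shiftS in h.
apply: (cvg_unique (@Rhausdorff R) h) => /=.
by apply: cvgMr_tmp; apply: cvgD; exact: cond_min1_cvg.
Qed.

Lemma cond_min1_bounds s : [/\ 0 <= cond_min1 f s, cond_min1 f s <= 1,
  cond_min1 f s <= f s & f s - 1 <= cond_min1 f s].
Proof.
have m0 : martingale (fun=> 0 : R) by apply/funext => t; rewrite /avg addr0 mul0r.
have m1 : martingale (fun t => f t - 1).
  by apply/funext => t; rewrite (martingaleE t mf) /avg; lra.
have := cond_min1_le 0 s; rewrite /= le_min => /andP[h1 h2]; split => //.
- suff : forall t, 0 <= Num.min (f t) 1 by exact: cond_min1_ge.
  by move=> t; have /andP[h _] := f02 t; rewrite le_min h ler01.
- suff : forall t, f t - 1 <= Num.min (f t) 1 by exact: cond_min1_ge.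
  move=> t; have /andP[_ h] := f02 t.
  by rewrite le_min; apply/andP; split; lra.
Qed.

Lemma alspach_alspach_set : alspach_set (alspach f).
Proof.
split; last 2 first.
- by case: Pf.
- elim/last_ind => [|s b _]; first exact: f02.
  rewrite alspach_rcons; have [h1 h2 h3 h4] := cond_min1_bounds s.
  by case: b; lra.
apply/funext; elim/last_ind => [|s b _]; first by rewrite /avg /=; lra.
rewrite /avg -!rcons_cons !alspach_rcons (martingaleE s mf).
by rewrite (martingaleE s cond_min1_martingale); case: b; lra.
Qed.

End OneMartingale.

(** u |-> min(u, 1) and u |-> u - min(u, 1) are both nondecreasing. *)
Lemma min1_split_norm (x y : R) :
  `|Num.min x 1 - Num.min y 1| + `|x - y - (Num.min x 1 - Num.min y 1)| <=
  `|x - y|.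
Proof.
have [x1|x1] := lerP x 1; have [y1|y1] := lerP y 1.
- by rewrite subrr normr0 addr0.
- by rewrite !ler0_norm; lra.
- by rewrite !ger0_norm; lra.
- by rewrite subrr normr0 add0r subr0.
Qed.

(** The map redistributes |f - g| over the two halves without loss, because
    the two truncations move in the same direction; the conditional
    expectations can only decrease the distance further. *)
Lemma alspach_nonexpansive f g (D : R) : alspach_set f -> alspach_set g ->
  (forall n, iter n avg (fun t => `|f t - g t|) [::] <= D) ->
  forall n, iter n avg (fun t => `|alspach f t - alspach g t|) [::] <= D.
Proof.
move=> Pf Pg fgD [|n]; first exact: (fgD 0%N).
rewrite avgnS_root -avgnD.
under eq_fun do rewrite !alspach_rcons.
pose mu k h s := iter k avg (fun t : seq bool => Num.min (h t : R) 1) s.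
pose d x y (z : R) : R := `|x - y| + `|z - (x - y)|.
have -> : iter n avg (fun s => `|2 * cond_min1 f s - 2 * cond_min1 g s| +
    `|2 * (f s - cond_min1 f s) - 2 * (g s - cond_min1 g s)|) [::] / 2 =
    iter n avg (fun s => d (cond_min1 f s) (cond_min1 g s) (f s - g s)) [::].
  have -> : (fun s => `|2 * cond_min1 f s - 2 * cond_min1 g s| +
    `|2 * (f s - cond_min1 f s) - 2 * (g s - cond_min1 g s)|) =
    (fun s => 2 * d (cond_min1 f s) (cond_min1 g s) (f s - g s) + 0).
    have abs2 (y : R) : 2 * `|y| = `|2 * y| by rewrite normrM ger0_norm.
    apply/funext => s; rewrite addr0 /d [RHS]mulrDr !abs2.
    by congr (_ + _); congr Num.norm; lra.
  by rewrite avgn_lin avgn_cst; lra.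
have h k : iter n avg (fun s => d (mu k f s) (mu k g s) (f s - g s)) [::] <= D.
  apply: le_trans (fgD (n + k)%N); rewrite iterD; apply: ler_avgn => s.
  rewrite /d -avgnB.
  have [[mf _ _] [mg _ _]] := (Pf, Pg).
  rewrite -{1}(martingale_avgn k s mf) -{1}(martingale_avgn k s mg) -!avgnB.
  apply: le_trans (lerD (avgn_norm _ _ _) (avgn_norm _ _ _)) _.
  rewrite -avgnD; apply: ler_avgn => t; move: (f t) (g t) => x y.
  exact: min1_split_norm.
have cv : iter n avg (fun s => d (mu k f s) (mu k g s) (f s - g s)) [::]
    @[k --> \oo] -->
    iter n avg (fun s => d (cond_min1 f s) (cond_min1 g s) (f s - g s)) [::].
  elim: n [::] {h} => [|n IH] s /=.
    have cfg : mu k f s - mu k g s @[k --> \oo] --> cond_min1 f s - cond_min1 g s.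
      by apply: cvgB; exact: cond_min1_cvg.
    by apply: cvgD; apply: cvg_norm => //; apply: cvgB => //; exact: cvg_cst.
  by apply: cvgMr_tmp; apply: cvgD; exact: IH.
rewrite -(cvg_lim (@Rhausdorff R) cv).
by apply: limr_le; [exact: cvgP cv | exact: nearW].
Qed.

Section FixedPoint.
Variable f : seq bool -> R.
Hypothesis Pf : alspach_set f.
Hypothesis fixf : alspach f = f.

Let mf : martingale f. Proof. by case: Pf. Qed.

Let f02 s : 0 <= f s <= 2. Proof. by case: Pf. Qed.

(** The distribution of a fixed point f is that of Alspach's image of f, so the
    mean of psi(f) is half the mean of psi'(f), where psi' is the sum
    of psi composed with each branch of the map.  One branch takes an endpoint
    value, where psi vanishes, so psi' obeys the same bound 1 as psi, and the
    halving can be repeated k times. *)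
Lemma fixed_avg_decay k (psi : R -> R) (L : R) : 0 <= L ->
  (forall x y, `|psi x - psi y| <= L * `|x - y|) ->
  (forall x, 0 <= x <= 2 -> psi x <= 1) -> psi 0 = 0 -> psi 2 = 0 ->
  forall e, 0 < e -> exists N, forall n, (N <= n)%N ->
  iter n avg (psi \o f) [::] <= 2 ^- k + e.
Proof.
elim: k psi L => [|k IH] psi L L0 Lip psi1 p0 p2 e e0.
  exists 0%N => n _; rewrite expr0 invr1 -[leRHS](avgn_cst n _ [::]).
  by apply: ler_avgn => t; rewrite (le_trans (psi1 _ (f02 t)))// lerDl ltW.
pose psi' u := psi (2 * Num.min u 1) + psi (2 * (u - Num.min u 1)).
have minlip x y : `|Num.min x 1 - Num.min y 1| <= `|x - y| :> R.
  by have := min1_split_norm x y; have := normr_ge0 (x - y - (Num.min x 1 - Num.min y 1)); lra.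
have [|||||N1 N1P] := IH psi' (6 * L) _ _ _ _ _ e e0.
- by rewrite mulr_ge0.
- move=> x y; rewrite /psi'.
  have h1 := Lip (2 * Num.min x 1) (2 * Num.min y 1).
  have h2 := Lip (2 * (x - Num.min x 1)) (2 * (y - Num.min y 1)).
  have h3 : L * `|2 * Num.min x 1 - 2 * Num.min y 1| <= L * (2 * `|x - y|).
    by rewrite ler_wpM2l// -mulrBr normrM ger0_norm// ler_pM2l.
  have h4 : L * `|2 * (x - Num.min x 1) - 2 * (y - Num.min y 1)| <=
      L * (4 * `|x - y|).
    rewrite ler_wpM2l// -mulrBr normrM ger0_norm//.
    have -> : x - Num.min x 1 - (y - Num.min y 1) =
      (x - y) - (Num.min x 1 - Num.min y 1) by ring.
    by have := minlip x y; have := ler_normB (x - y) (Num.min x 1 - Num.min y 1); lra.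
  rewrite opprD addrACA (le_trans (ler_normD _ _))//; lra.
- move=> x x02; rewrite /psi'; case: (lerP x 1) => x1.
    by rewrite subrr mulr0 p0 addr0 psi1//; lra.
  by rewrite mulr1 p2 add0r psi1//; lra.
- by rewrite /psi' min_l// mulr0 subrr mulr0 p0 addr0.
- by rewrite /psi' min_r ?ler1n// mulr1 p2 add0r; have -> : 2 * (2 - 1) = 2 :> R by lra.
have e1 : 0 < e / (4 * L + 4) by rewrite divr_gt0//; lra.
have := @cond_min1_cvg _ Pf [::] => /cvgrPdist_le/(_ _ e1)[N2 _ N2P].
exists (maxn N1 N2).+1 => -[//|n]; rewrite ltnS geq_max => /andP[n1 n2].
rewrite avgnS_root -avgnD.
have {N2P} : iter n avg (fun t => Num.min (f t) 1) [::] - cond_min1 f [::]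
    <= e / (4 * L + 4).
  have /= := N2P _ n2; rewrite distrC; exact: le_trans (ler_norm _).
have {N1P} := N1P _ n1.
rewrite -{1}(martingale_avgn n [::] (cond_min1_martingale Pf)) -avgnB.
set a := iter n avg _ _; set b := iter n avg _ _ => ha hb.
have : iter n avg (fun t => (psi \o f) (rcons t false) + (psi \o f) (rcons t true)) [::]
    <= 4 * L * b + a.
  rewrite -avgn_lin; apply: ler_avgn => s /=.
  rewrite -{1 2}fixf !alspach_rcons /psi'.
  have [h1 h2 h3 h4] := cond_min1_bounds Pf s.
  have h0 := cond_min1_le Pf 0 s; rewrite /= in h0.
  have := Lip (2 * cond_min1 f s) (2 * Num.min (f s) 1).
  have := Lip (2 * (f s - cond_min1 f s)) (2 * (f s - Num.min (f s) 1)).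
  set m := Num.min _ _ in h0 *.
  have -> : 2 * (f s - cond_min1 f s) - 2 * (f s - m) = 2 * (m - cond_min1 f s) by ring.
  have -> : 2 * cond_min1 f s - 2 * m = - (2 * (m - cond_min1 f s)) by ring.
  have nE : `|2 * (m - cond_min1 f s)| = 2 * (m - cond_min1 f s).
    by rewrite ger0_norm// mulr_ge0// subr_ge0.
  rewrite normrN nE.
  rewrite mulrCA -/m => /(le_trans (ler_norm _)) + /(le_trans (ler_norm _)).
  lra.
have : 4 * L * b <= e.
  apply: (le_trans (ler_wpM2l _ hb)); first lra.
  rewrite mulrCA -ler_pdivlMl// mulVf ?gt_eqF// ler_pdivrMr; lra.
have -> : 2 ^- k.+1 = 2 ^- k / 2 :> R by rewrite exprS invfM mulrC.
by move: ha; lra.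
Qed.

(** By the decay, a fixed point takes only the values 0 and 2, in the sense that
    the tent 1 - |u - 1| has mean 0 along f.  Then min(f, 1) = f / 2 and f
    has the same averages on both halves at every scale: f is the constant 1,
    where the tent is 1. *)
Lemma alspach_fixed_absurd : False.
Proof.
have f1 : f [::] = 1 by case: Pf.
pose psi (u : R) := 1 - `|u - 1|.
have minE u : Num.min u 1 = 2^-1 * u + 2^-1 * psi u.
  by rewrite /psi; have [h|h] := lerP u 1; lra.
have psi0 s : 0 <= psi (f s).
  by have := f02 s; rewrite /psi subr_ge0 ler_norml; lra.
have t_ge s : 2^-1 * f s <= cond_min1 f s.
  apply: (@cond_min1_ge _ Pf (fun s => 2^-1 * f s) s).
    by apply/funext => t; rewrite (martingaleE t mf) /avg; lra.
  by move=> t; rewrite minE lerDl mulr_ge0.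
have t_root : cond_min1 f [::] <= 2^-1.
  apply/ler_addgt0Pr => e e0.
  have [k] : exists k, 2 ^- k < e.
    have : (fun k => (2^-1 : R) ^+ k) @ \oo --> 0.
      by apply: cvg_expr; rewrite ger0_norm ?invr_ge0// invf_lt1// ltr1n.
    move=> /cvgrPdist_lt/(_ _ e0)[k _ kP]; exists k.
    have := kP k (leqnn k); rewrite /= sub0r normrN exprVn ger0_norm//.
  have [||||N NP] := @fixed_avg_decay k psi 1 ler01 _ _ _ _ e e0.
  - move=> x y; rewrite mul1r /psi.
    have -> : 1 - `|x - 1| - (1 - `|y - 1|) = `|y - 1| - `|x - 1| by ring.
    rewrite (le_trans (ler_dist_dist _ _))//.
    have -> : y - 1 - (x - 1) = - (x - y) by ring.
    by rewrite normrN.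
  - by move=> x _; rewrite /psi lerBlDr lerDl.
  - by rewrite /psi sub0r normrN normr1 subrr.
  - have h : 2 - 1 = 1 :> R by lra.
    by rewrite /psi h normr1 subrr.
  have := NP N (leqnn N).
  have := cond_min1_le Pf N [::].
  have -> : (fun t => Num.min (f t) 1) =
     (fun t => 2^-1 * f t + (2^-1 * (psi \o f) t + 0)).
    by apply/funext => t; rewrite minE addr0.
  rewrite !avgn_lin avgn_cst martingale_avgn// f1; lra.
have tE s : cond_min1 f s = 2^-1 * f s.
  apply/eqP; rewrite eq_le t_ge andbT -subr_le0.
  have := @node_le_avgn _ (fun s => cond_min1 f s - 2^-1 * f s) s.
  have -> : iter (size s) avg (fun s => cond_min1 f s - 2^-1 * f s) [::] =
    cond_min1 f [::] - 2^-1.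
    rewrite avgnB martingale_avgn; last exact: cond_min1_martingale.
    under eq_fun do rewrite -[_ * _]addr0.
    by rewrite avgn_lin avgn_cst martingale_avgn// f1 mulr1 addr0.
  move=> h; apply: le_trans (h _) _; first by move=> t; rewrite subr_ge0.
  by rewrite mulr_ge0_le0// subr_le0.
have f_cst s : f s = 1.
  elim/last_ind: s => // s b IH.
  by rewrite -fixf alspach_rcons tE IH; case: b; lra.
have := @cond_min1_cvg _ Pf [::].
under eq_fun do under [X in iter _ _ X]eq_fun do rewrite f_cst minxx.
under eq_fun do rewrite avgn_cst.
move=> h.
have : 1 = cond_min1 f [::] by apply: (cvg_unique (@Rhausdorff R) _ h); exact: cvg_cst.
rewrite tE f1; lra.
Qed.

End FixedPoint.

End AlspachMap.

(** * Averages of vectors and compactness of the set of martingales *)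

Section VectorAverages.
Context {R : realType} {E : lmodType R}.
Implicit Types (g h : seq bool -> E) (n k : nat) (s t : seq bool).

Definition vavg g s : E := 2^-1 *: (g (false :: s) + g (true :: s)).

Lemma vavgn_lin n a b g h s :
  iter n vavg (fun t => a *: g t + b *: h t) s =
  a *: iter n vavg g s + b *: iter n vavg h s.
Proof.
elim: n s => [|n IH] s //=; rewrite /vavg !IH !scalerA (mulrC a) (mulrC b).
by rewrite -!scalerA -scalerDr !scalerDr addrACA.
Qed.

(** Isolates a single vector of a tree from an average over its level. *)
Lemma vavgn_delta h s :
  iter (size s) vavg (fun t => (t == s)%:R *: h t) [::] =
  (2^-1 ^+ size s : R) *: h s.
Proof.
elim: s h => [|b s IH] h; first by rewrite /= expr0.
rewrite [size _]/= iterSr exprSr -scalerA.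
rewrite -(IH (fun s => 2^-1 *: h (b :: s))); congr (iter _ vavg _ [::]).
apply/funext => t; rewrite /vavg !eqseq_cons scalerA mulrC -scalerA.
by congr (_ *: _); case: b; case: (t == s); rewrite /= ?scale0r ?scale1r ?addr0 ?add0r.
Qed.

Lemma avgn_delta s :
  iter (size s) avg (fun t => `|(t == s)%:R : R|) [::] = 2^-1 ^+ size s.
Proof.
elim: s => [|b s IH]; first by rewrite /= normr1 expr0.
rewrite [size _]/= iterSr exprS -IH.
have -> : avg (fun t => `|(t == b :: s)%:R : R|) =
    fun t => 2^-1 * `|(t == s)%:R : R| + 0.
  apply/funext => t; rewrite /avg !eqseq_cons mulrC addr0; congr (_ * _).
  by case: b; case: (t == s); rewrite /= ?normr0 ?addr0 ?add0r.
by rewrite avgn_lin avgn_cst addr0.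
Qed.

Lemma vavgn_linfun n (phi : {linear E -> R^o}) g s :
  phi (iter n vavg g s) = iter n avg (phi \o g) s.
Proof.
by elim: n s => [|n IH] s //=; rewrite /vavg /avg linearZ linearD !IH mulrC.
Qed.

End VectorAverages.

Lemma alspach_set_compact {R : realType} :
  compact (alspach_set : set (prod_topology (fun _ : seq bool => R^o))).
Proof.
apply: (@subclosed_compact (prod_topology (fun _ : seq bool => R^o)) _
   [set f : prod_topology (fun _ : seq bool => R^o) |
     forall s, `[0, 2]%classic (f s)]).
- have projc s : continuous (fun f : prod_topology (fun _ : seq bool => R^o) => f s).
    exact: proj_continuous.
  have -> : alspach_set =
     (\bigcap_s [set f : prod_topology (fun _ : seq bool => R^o) |
        (f s - avg f s) \in [set x : R | x = 0]])
     `&` [set f | f [::] \in [set x : R | x = 1]]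
     `&` \bigcap_s [set f | f s \in [set x : R | 0 <= x]]
     `&` \bigcap_s [set f | f s \in [set x : R | x <= 2]].
    apply/seteqP; split => [f [mf f1 fb]|f [[[mf f1] f0] f2]].
      split; [split; [split|]|] => /=.
      - by move=> s _ /=; rewrite inE/= mf subrr.
      - by rewrite inE.
      - by move=> s _ /=; rewrite inE/=; have /andP[] := fb s.
      - by move=> s _ /=; rewrite inE/=; have /andP[] := fb s.
    split.
    - apply/funext => s; have /set_mem /eqP := mf s I.
      by rewrite subr_eq0 eq_sym => /eqP.
    - exact/set_mem.
    - by move=> s; rewrite (set_mem (f0 s I)) (set_mem (f2 s I)).
  have cl (A : set R) (h : prod_topology (fun _ : seq bool => R^o) -> R^o) :
     closed A -> continuous h -> closed [set f | h f \in A].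
    move=> clA ch; under eq_set do rewrite in_setE.
    exact: (closed_comp (fun f _ => ch f) clA).
  apply: closedI; [apply: closedI; [apply: closedI|]|].
  - apply: closed_bigI => s _; apply: (cl _ (fun f => f s - avg f s)).
      exact: closed_eq.
    move=> f; have pf t : (fun g => g t : R) @ nbhs f --> f t := @projc t f.
    have af : (fun g => avg g s : R) @ nbhs f --> avg f s.
      have h := @cvgD _ _ _ _ (nbhs_filter f) _ _ _ _
        (pf (false :: s)) (pf (true :: s)).
      exact: (@cvgMr_tmp _ _ _ (nbhs_filter f) _ _ 2^-1 h).
    exact: (@cvgB _ _ _ _ (nbhs_filter f) _ _ _ _ (pf s) af).
  - by apply: cl; [exact: closed_eq | exact: projc].
  - by apply: closed_bigI => s _; apply: cl; [exact: closed_ge | exact: projc].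
  - by apply: closed_bigI => s _; apply: cl; [exact: closed_le | exact: projc].
- exact: (@tychonoff _ (fun _ : seq bool => R^o) (fun=> `[0, 2]%classic)
    (fun=> @segment_compact R 0 2)).
- by move=> f [_ _ fb] s /=; rewrite in_itv/= fb.
Qed.

(** * Normed spaces containing a dyadic tree *)

Section DyadicTree.
Context {R : realType} {E : normedModType R}.
Variable v : seq bool -> E.

(** When v_s is the normalized indicator 2^|s| 1_s of the dyadic interval s,
    this is the step function equal to f(s) on each interval s of level n. *)
Definition tree_sum (f : seq bool -> R) n : E :=
  iter n vavg (fun s => f s *: v s) [::].

Hypothesis v_avg : vavg v = v.
Hypothesis v_norm : forall n (f : seq bool -> R),
  `|tree_sum f n| = iter n avg (fun s => `|f s|) [::].
Hypothesis v_cvg : forall f, alspach_set f -> cvgn (tree_sum f).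

Definition tree_lim f : E := limn (tree_sum f).

Let tree_limP f : alspach_set f -> tree_sum f @ \oo --> tree_lim f.
Proof. by move=> /v_cvg. Qed.

Lemma tree_sum_lin a b f g n :
  tree_sum (fun s => a * f s + b * g s) n = a *: tree_sum f n + b *: tree_sum g n.
Proof.
rewrite /tree_sum -vavgn_lin; congr (iter n vavg _ [::]).
by apply/funext => s; rewrite scalerDl !scalerA.
Qed.

Lemma dist_tree_lim f g : alspach_set f -> alspach_set g ->
  iter n avg (fun s => `|f s - g s|) [::] @[n --> \oo] -->
    `|tree_lim f - tree_lim g|.
Proof.
move=> Pf Pg.
have h : `|tree_sum f n - tree_sum g n| @[n --> \oo] -->
    `|tree_lim f - tree_lim g|.
  by apply: cvg_norm; apply: cvgB; exact: tree_limP.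
apply: cvg_trans h; apply: near_eq_cvg; apply: nearW => n.
rewrite -[tree_sum f n]scale1r -scaleN1r -tree_sum_lin v_norm.
by congr (iter n avg _ [::]); apply/funext => s; rewrite mul1r mulN1r.
Qed.

Lemma avgn_dist_le_tree_lim f g n : alspach_set f -> alspach_set g ->
  iter n avg (fun s => `|f s - g s|) [::] <= `|tree_lim f - tree_lim g|.
Proof.
move=> Pf Pg; have h := dist_tree_lim Pf Pg.
rewrite -(cvg_lim (@Rhausdorff R) h).
have [[mf _ _] [mg _ _]] := (Pf, Pg).
apply: (nondecreasing_cvgn_le _ (cvgP _ h)).
move=> a b ab; apply: (avgn_norm_homo [::] _ ab).
by apply/funext => s; rewrite /avg (martingaleE s mf) (martingaleE s mg); lra.
Qed.

(** The vectors of the tree have norm 1: test the norm formula on the indicator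
    of a node. *)
Lemma tree_functional_bounded (phi : {linear E -> R^o}) : continuous phi ->
  exists M : R, forall s, `|phi (v s)| <= M.
Proof.
move=> /linear_bounded_continuous/bounded_funP/(_ 1)[M phiM].
exists M => s; apply: phiM.
have := v_norm (size s) (fun t => (t == s)%:R).
rewrite /tree_sum vavgn_delta avgn_delta normrZ ger0_norm ?exprn_ge0//.
by move/eqP; rewrite -subr_eq0 -{2}[_ ^+ _]mulr1 -mulrBr mulf_eq0 expf_eq0 invr_eq0
   pnatr_eq0 andbF/= subr_eq0 => /eqP ->.
Qed.

(** phi(v_s) is a bounded martingale, hence nearly constant in L^1 beyond some
    level n; since 0 <= f <= 2, replacing it by its level n changes its pairing
    with f by little, uniformly in f. *)
Lemma tree_functional_approx (phi : {linear E -> R^o}) : continuous phi ->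
  forall e : R, 0 < e -> exists n, forall f, alspach_set f ->
  `|phi (tree_lim f) - iter n avg (fun s => f s * phi (v s)) [::]| <= e.
Proof.
move=> cphi e e0; have [M phiM] := tree_functional_bounded cphi.
pose G s : R := phi (v s).
have mG : martingale G.
  apply/funext => s; rewrite /G -{2}v_avg /vavg linearZ linearD /avg mulrC//.
have e20 : 0 < e / 2 by rewrite divr_gt0.
have [N NP] := martingale_cauchy mG phiM e20.
exists N => f Pf; have [mf _ f02] := Pf.
have h : phi (tree_sum f n) @[n --> \oo] --> phi (tree_lim f).
  by apply: (cvg_comp _ _ (tree_limP Pf)); exact: cphi.
have {}h : iter n avg (fun s => f s * G s) [::] @[n --> \oo] --> phi (tree_lim f).
  apply: cvg_trans h; apply: near_eq_cvg; apply: nearW => n.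
  rewrite /tree_sum vavgn_linfun; congr (iter n avg _ [::]).
  by apply/funext => s /=; rewrite linearZ.
set c := iter N _ _ _.
have {}h : `|iter n avg (fun s => f s * G s) [::] - c| @[n --> \oo] -->
    `|phi (tree_lim f) - c|.
  by apply: cvg_norm; apply: cvgB => //; exact: cvg_cst.
rewrite -(cvg_lim (@Rhausdorff R) h); apply: limr_le; first exact: cvgP h.
exists N => // n /= Nn; have := NP N (n - N)%N (leqnn N).
rewrite subnKC// => hn.
have -> : c = iter n avg (fun s => f s * G (drop (n - N) s)) [::].
  rewrite -{1}(subnKC Nn) iterD; congr (iter N avg _ [::]).
  by apply/funext => s; rewrite avgn_lift martingale_avgn.
rewrite -avgnB (le_trans (avgn_norm _ _ _))//.
apply: le_trans (_ : iter n avg (fun s => 2 * `|G s - G (drop (n - N) s)| + 0) [::]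
  <= _).
  apply: ler_avgn => s; rewrite -mulrBr normrM addr0 ler_wpM2r//.
  by rewrite ger0_norm; have /andP[] := f02 s.
rewrite avgn_lin avgn_cst; lra.
Qed.

(** A uniform limit of functions that depend on finitely many coordinates. *)
Lemma tree_lim_weakly_continuous :
  {within (alspach_set : set (prod_topology (fun _ : seq bool => R^o))),
    continuous (tree_lim : prod_topology (fun _ : seq bool => R^o) -> weak_space E)}.
Proof.
apply/subspace_continuousP => f Pf.
apply/cvg_sup => -[phi cphi] A /=.
move=> hA; have : nbhs (tree_lim f : initial_topology (phi : E -> R^o)) A := hA.
rewrite nbhsE => -[B [[C oC <-] Cf] CA].
apply: filterS CA _.
have : nbhs (phi (tree_lim f)) C by apply: open_nbhs_nbhs.
move=> /nbhs_ballP[e /= e0 eC].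
have e30 : 0 < e / 4 by rewrite divr_gt0.
have [n nP] := tree_functional_approx cphi e30.
pose H (g : prod_topology (fun _ : seq bool => R^o)) : R :=
  iter n avg (fun s => g s * phi (v s)) [::].
have cH : H @ nbhs f --> H f.
  rewrite /H; elim: n [::] {nP H} => [|n IH] s /=.
    have h := @proj_continuous _ (fun _ : seq bool => R^o) s f.
    exact: (@cvgMr_tmp R _ _ (nbhs_filter f) _ _ (phi (v s)) h).
  have h := @cvgD R R^o _ _ (nbhs_filter f) _ _ _ _ (IH (false :: s)) (IH (true :: s)).
  exact: (@cvgMr_tmp R _ _ (nbhs_filter f) _ _ 2^-1 h).
have /cvgrPdist_lt/(_ _ e30) nH := cH.
apply: filterS nH => g gH Pg /=; apply: eC => /=; rewrite /ball/=.
have := nP _ Pf; have := nP _ Pg; move: gH; rewrite -/(H f) -/(H g).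
set a := H f; set b := H g => h1 h2 h3.
have -> : phi (tree_lim f) - phi (tree_lim g) =
  (phi (tree_lim f) - a) + ((a - b) - (phi (tree_lim g) - b)) by ring.
apply: le_lt_trans (ler_normD _ _) _.
have := ler_normB (a - b) (phi (tree_lim g) - b).
lra.
Qed.

Theorem dyadic_tree_not_wfpp : ~ wfpp E.
Proof.
pose K := tree_lim @` alspach_set.
pose rep x := xget (cst 0) [set f | alspach_set f /\ tree_lim f = x].
have repP x : K x -> alspach_set (rep x) /\ tree_lim (rep x) = x.
  by move=> [f Pf fx]; rewrite /rep; case: xgetP => [g -> //|/(_ f)[]].
have K0 : K !=set0.
  exists (tree_lim (cst 1)), (cst 1) => //; split => //.
    by apply/funext => s; rewrite /avg /cst/=; lra.
  by move=> s; rewrite /cst/=; lra.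
have Kcompact : weakly_compact K.
  exact: (continuous_compact tree_lim_weakly_continuous alspach_set_compact).
have Kconvex : convex_set (K : set (convex_lmodType E)).
  move=> x y l /set_mem[f Pf <-] /set_mem[g Pg <-]; apply/mem_set.
  have l0 : 0 <= l%:num by [].
  have l1 : l%:num <= 1 by [].
  exists (fun s => l%:num * f s + (1 - l%:num) * g s).
    have [[mf f1 f02] [mg g1 g02]] := (Pf, Pg); split.
    - by apply/funext => s; rewrite /avg (martingaleE s mf) (martingaleE s mg); lra.
    - by rewrite f1 g1; lra.
    - move=> s; have /andP[ga gb] := g02 s; have /andP[fa fb] := f02 s.
      by move: (f s) (g s) fa fb ga gb l0 l1 => x' y'; move: (l%:num) => r *; nra.
  apply: cvg_lim; first exact: norm_hausdorff.
  rewrite (_ : tree_sum _ =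
    fun n => l%:num *: tree_sum f n + (1 - l%:num) *: tree_sum g n).
    by apply: cvgD; apply: cvgZl_tmp; exact: tree_limP.
  by apply/funext => n; rewrite tree_sum_lin.
move=> /(_ K K0 Kcompact Kconvex (tree_lim \o alspach \o rep)) [x /repP[]||].
- exists (alspach (rep x)) => //; exact: alspach_alspach_set.
- move=> x y /set_mem/repP[Px xE] /set_mem/repP[Py yE] /=.
  rewrite -[in leRHS]xE -[in leRHS]yE.
  have h := dist_tree_lim (alspach_alspach_set Px) (alspach_alspach_set Py).
  rewrite -(cvg_lim (@Rhausdorff R) h); apply: limr_le; first exact: cvgP h.
  apply: nearW; apply: alspach_nonexpansive => // n.
  exact: avgn_dist_le_tree_lim.
move=> x /repP[Px xE] /= fixx; apply: (alspach_fixed_absurd Px).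
apply/funext => s; apply/eqP; rewrite -subr_eq0 -normr_le0.
have := node_le_avgn s (fun t => normr_ge0 (alspach (rep x) t - rep x t)).
move=> /le_trans; apply; rewrite mulr_ge0_le0//.
have := avgn_dist_le_tree_lim (size s) (alspach_alspach_set Px) Px.
by rewrite fixx xE subrr normr0.
Qed.

End DyadicTree.

(** * A dyadic tree in spaces with sup-norm blocks *)

Section SignPatterns.
Context {R : realType}.
Implicit Types (f g : seq bool -> R) (n k m : nat) (s t : seq bool).

Lemma eq_avgn n f g s :
  (forall r, size r = n -> f (r ++ s) = g (r ++ s)) ->
  iter n avg f s = iter n avg g s.
Proof.
elim: n s => [|n IH] s fg; first exact: (fg [::]).
rewrite /= /avg; congr ((_ + _) / _); apply: IH => r rn;
  by rewrite -cat_rcons fg// size_rcons rn.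
Qed.

Lemma eq_avgn_root n f g :
  (forall s, size s = n -> f s = g s) -> iter n avg f [::] = iter n avg g [::].
Proof. by move=> fg; apply: eq_avgn => r rn; rewrite cats0 fg. Qed.

(** The martingale of the step function with value g(s) on each node s of
    level n: it averages g above that level and is constant below. *)
Definition stopped n g t : R :=
  iter (n - size t) avg g (drop (size t - n) t).

Lemma stopped_martingale n g : martingale (stopped n g).
Proof.
apply/funext => t; rewrite /avg /stopped /=.
have [tn|nt] := ltnP (size t) n.
  have -> : (size t - n = 0)%N by apply/eqP; rewrite subn_eq0 ltnW.
  have /eqP -> : ((size t).+1 - n == 0)%N by rewrite subn_eq0.
  by rewrite !drop0 -[in RHS](prednK (_ : 0 < n - size t)%N) ?subn_gt0// subnS.
have /eqP -> : (n - size t == 0)%N by rewrite subn_eq0.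
have /eqP -> : (n - (size t).+1 == 0)%N by rewrite subn_eq0 ltnW.
by rewrite subSn//=; lra.
Qed.

Lemma avgn_mul_stopped p n f g : martingale f -> (p <= n)%N ->
  iter n avg (fun s => f s * stopped p g s) [::] =
  iter p avg (fun s => f s * g s) [::].
Proof.
move=> mf pn.
rewrite (@eq_avgn_root _ _ (fun s => f s * g (drop (n - p) s))); last first.
  move=> s sn; rewrite /stopped sn.
  by have /eqP -> : (p - n == 0)%N by rewrite subn_eq0.
rewrite -[in LHS](subnKC pn) iterD; congr (iter p avg _ [::]).
by apply/funext => s; rewrite subnKC// avgn_lift martingale_avgn.
Qed.

Lemma avgn_mul_stopped_early p n f g : (n <= p)%N ->
  iter n avg (fun s => f s * stopped p g s) [::] =
  iter p avg (fun s => f (drop (p - n) s) * g s) [::].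
Proof.
move=> np.
rewrite -[in RHS](subnKC np) iterD; apply: eq_avgn_root => s sn.
rewrite subnKC// /stopped sn.
have /eqP -> : (n - p == 0)%N by rewrite subn_eq0.
rewrite drop0 mulrC -avgn_lift; congr (iter _ avg _ s).
by apply/funext => t; rewrite mulrC.
Qed.

(** Signs are coded by the finite set of nodes where they are positive, so that
    there are countably many of them. *)
Definition sign_on (l : seq (seq bool)) s : R := if s \in l then 1 else -1.

Lemma norm_sign_on l s : `|sign_on l s| = 1.
Proof. by rewrite /sign_on; case: ifP; rewrite ?normrN normr1. Qed.

Lemma sign_on_norm n f : exists l, forall s, size s = n -> f s * sign_on l s = `|f s|.
Proof.
exists [seq s <- [seq val u | u <- enum {: n.-tuple bool}] | 0 <= f s] => s /eqP sn.
rewrite /sign_on mem_filter; have -> : s \in [seq val u | u <- enum {: n.-tuple bool}].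
  by apply/mapP; exists (Tuple sn); rewrite ?mem_enum.
rewrite andbT; have [h|h] := leP 0 (f s).
  by rewrite mulr1 ger0_norm.
by rewrite mulrN1 ltr0_norm.
Qed.

(** The 2-adic valuation takes every value infinitely often, so every level and
    sign choice recurs infinitely often along m. *)
Definition pattern m : nat * seq (seq bool) :=
  odflt (0%N, [::]) (unpickle (logn 2 m)).

Lemma pattern_frequent (x : nat * seq (seq bool)) N :
  exists2 m, (N <= m)%N & pattern m = x.
Proof.
exists (2 ^ pickle x * (2 * N).+1)%N.
  have := expn_gt0 2 (pickle x); move: (2 ^ _)%N => a /=; nia.
rewrite /pattern lognM ?expn_gt0// pfactorK// (@logn_coprime 2 (2 * N).+1).
  by rewrite addn0 pickleK.
by rewrite prime_coprime// dvdn2 /= oddM.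
Qed.

(** The m-th coordinate of the vector v_s of l^oo: the pairing of the normalized
    indicator of s with the m-th sign pattern. *)
Definition pattern_coord s m : R :=
  stopped (pattern m).1 (sign_on (pattern m).2) s.

Lemma pattern_coord_le1 s m : `|pattern_coord s m| <= 1.
Proof.
rewrite /pattern_coord /stopped (le_trans (avgn_norm _ _ _))//.
by under eq_fun do rewrite norm_sign_on; rewrite avgn_cst.
Qed.

Lemma avgn_mul_le n f h : (forall s, `|h s| <= 1) -> forall t,
  `|iter n avg (fun s => f s * h s) t| <= iter n avg (fun s => `|f s|) t.
Proof.
move=> h1 t; apply: le_trans (avgn_norm _ _ _) _; apply: ler_avgn => s.
by rewrite normrM ler_piMr.
Qed.

End SignPatterns.

Section SupNormBlocks.
Context {R : realType} {E : normedModType R}.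
Variable J : (nat -> R) -> E.

Definition bounded_seq (c : nat -> R) := exists B, forall m, `|c m| <= B.

Hypothesis J_lin : forall a b c d, bounded_seq c -> bounded_seq d ->
  J (fun m => a * c m + b * d m) = a *: J c + b *: J d.
Hypothesis J_le : forall c B, (forall m, `|c m| <= B) -> `|J c| <= B.
Hypothesis J_ge : forall c B, bounded_seq c ->
  (forall N, exists2 m, (N <= m)%N & B <= `|c m|) -> B <= `|J c|.

Let v s : E := J (pattern_coord s).

Let coord_bounded s : bounded_seq (pattern_coord s).
Proof. by exists 1 => m; exact: pattern_coord_le1. Qed.

Let avgn_bounded n (f : seq bool -> R) t :
  bounded_seq (fun m => iter n avg (fun s => f s * pattern_coord s m) t).
Proof.
exists (iter n avg (fun s => `|f s|) t) => m.
by apply: avgn_mul_le => s; exact: pattern_coord_le1.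
Qed.

Let tree_sumE f n :
  tree_sum v f n = J (fun m => iter n avg (fun s => f s * pattern_coord s m) [::]).
Proof.
rewrite /tree_sum; elim: n [::] => [|n IH] t /=.
  have -> : (fun m => f t * pattern_coord t m) =
     fun m => f t * pattern_coord t m + 0 * pattern_coord t m.
    by apply/funext => m; rewrite mul0r addr0.
  by rewrite J_lin// scale0r addr0.
rewrite /vavg !IH scalerDr -J_lin; [|exact: avgn_bounded..].
by congr J; apply/funext => m; rewrite [in RHS]/avg; lra.
Qed.

(** The sign of the n-th level of f is one of the patterns, so the supremum over
    the patterns recovers the L^1 norm of every level: this embeds L^1 in l^oo
    by duality.  The values of the coordinates recur infinitely often, as the
    lower estimate for J requires. *)
Theorem sup_norm_blocks_not_wfpp : ~ wfpp E.
Proof.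
apply: (@dyadic_tree_not_wfpp _ _ v).
- apply/funext => s; rewrite /vavg /v scalerDr -J_lin//; congr J.
  apply/funext => m; rewrite /pattern_coord.
  by rewrite [RHS](martingaleE s (stopped_martingale _ _)); lra.
- move=> n f; rewrite tree_sumE; apply/eqP; rewrite eq_le; apply/andP; split.
    by apply: J_le => m; apply: avgn_mul_le => s; exact: pattern_coord_le1.
  apply: J_ge => [|N]; first exact: avgn_bounded.
  have [l lP] := sign_on_norm n f.
  have [m Nm mE] := pattern_frequent (n, l) N; exists m => //.
  rewrite (@eq_avgn_root _ _ _ (fun s => `|f s|)) ?ler_norm// => s sn.
  by rewrite /pattern_coord mE /stopped sn subnn drop0 lP.
- move=> f [mf _ f02].
  (* The limit has to be the pairing of f with the patterns; patterns of level
     at most n already give it exactly on the n-th step function. *)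
  pose c m := iter (pattern m).1 avg (fun s => f s * sign_on (pattern m).2 s) [::].
  have sign1 l s : `|sign_on l s : R| <= 1 by rewrite norm_sign_on.
  have f2 s : `|f s| <= 2 by have /andP[f0 f2] := f02 s; rewrite ger0_norm.
  have c_bounded : bounded_seq c.
    exists 2 => m; rewrite -[leRHS](avgn_cst (pattern m).1 _ [::]).
    apply: le_trans (avgn_mul_le _ _ (sign1 _) _) _; exact: ler_avgn.
  apply: (cvgP (J c)); apply/cvgrPdist_le => e e0.
  have [N NP] := martingale_cauchy mf f2 e0.
  exists N => // n /= Nn; rewrite tree_sumE -[J c]scale1r -scaleN1r -J_lin//.
  apply: J_le => m; rewrite mul1r mulN1r /c /pattern_coord.
  set p := (pattern m).1; set l := (pattern m).2.
  have [pn|np] := leqP p n.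
    by rewrite avgn_mul_stopped// subrr normr0 ltW.
  rewrite avgn_mul_stopped_early ?(ltnW np)// -avgnB.
  under eq_fun do rewrite -mulrBl.
  apply: le_trans (avgn_mul_le _ _ (sign1 _) _) _.
  by have := NP n (p - n)%N Nn; rewrite subnKC// ltnW.
Qed.

End SupNormBlocks.

(** * Densities of bounded dyadic martingales *)

Section DyadicPaths.
Context {R : realType}.
Implicit Types (f g : seq bool -> R) (n k m : nat) (s t : seq bool) (x : R).

Local Notation leb := (@lebesgue_measure R).
#[local] Hint Extern 0 (Filter (nbhs (almost_everywhere _))) =>
  (exact: (ae_filter_ringOfSetsType leb)) : typeclass_instances.

(** The root is the interval [1/2, 1[, which stays away from the singularity
    of the weights at 0 and lies in both [0, 1] and the half-line. *)
Fixpoint node_left s : R :=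
  if s is b :: t then node_left t + b%:R * 2 ^- (size t).+2 else 2^-1.

Definition node_itv s : set R :=
  `[node_left s, node_left s + 2 ^- (size s).+1[%classic.

(** The node of n generations below s whose interval contains x, for x in the
    interval of s.  Descending from s compares x with fixed thresholds, which
    makes measurability and integration inductive. *)
Fixpoint path_from n s x : seq bool :=
  if n is n'.+1 then path_from n' ((node_left (true :: s) <= x) :: s) x else s.

Lemma measurable_node_itv s : measurable (node_itv s).
Proof. exact: measurable_itv. Qed.

Lemma measure_node_itv s : leb (node_itv s) = (2 ^- (size s).+1)%:E.
Proof.
rewrite /node_itv lebesgue_measure_itv/= lte_fin ltrDl invr_gt0 exprn_gt0//.
by rewrite -EFinD addrAC subrr add0r.
Qed.

Lemma path_fromD n k s x :
  path_from (n + k) s x = path_from k (path_from n s x) x.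
Proof. by elim: n s => [|n IH] s //=. Qed.

Lemma drop_path_from k s x : drop k (path_from k s x) = s.
Proof.
elim: k s => [|k IH] s; first by rewrite drop0.
by rewrite -add1n -drop_drop IH /= drop0.
Qed.

Lemma measurable_path_from f n s :
  measurable_fun setT (fun x => f (path_from n s x)).
Proof.
elim: n s => [|n IH] s /=; first exact: measurable_cst.
rewrite (_ : (fun x => _) = fun x => if node_left (true :: s) <= x
  then f (path_from n (true :: s) x) else f (path_from n (false :: s) x)).
  apply: measurable_fun_ifT; [|exact: IH..].
  by apply: measurable_fun_ler; [exact: measurable_cst | exact: measurable_id].
by apply/funext => x /=; case: ifP.
Qed.

Lemma node_itv_split s :
  node_itv s = node_itv (false :: s) `|` node_itv (true :: s) /\
  [disjoint node_itv (false :: s) & node_itv (true :: s)].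
Proof.
have e : 2 ^- (size s).+1 = 2 * 2 ^- (size s).+2 :> R.
  by rewrite [in RHS]exprS invfM mulVKf ?pnatr_eq0.
have p : 0 < 2 ^- (size s).+2 :> R by rewrite invr_gt0 exprn_gt0.
rewrite /node_itv /= mul0r mul1r addr0 e.
move: (node_left s) (2 ^- (size s).+2) p => l d p; split.
  apply/seteqP; split => x /=; rewrite !in_itv/=.
    by move=> /andP[h1 h2]; have [h|h] := ltP x (l + d); [left|right]; lra.
  by case; lra.
apply/disj_setPS => x [] /=; rewrite !in_itv/=; lra.
Qed.

Lemma integral_path_from f n s : (forall t, 0 <= f t) ->
  (\int[leb]_(x in node_itv s) (f (path_from n s x))%:E =
   (2 ^- (size s).+1 * iter n avg f s)%:E)%E.
Proof.
move=> f0; elim: n s => [|n IH] s.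
  rewrite (@integral_cst _ _ _ leb _ (measurable_node_itv s) (f s)%:E).
  transitivity ((f s)%:E * (2 ^- (size s).+1)%:E)%E; last by rewrite -EFinM mulrC.
  by congr (_ * _)%E; exact: measure_node_itv.
have [-> dis] := node_itv_split s.
rewrite ge0_integral_setU//=; [|exact: measurable_node_itv..| |].
- rewrite (@eq_integral _ _ _ leb (node_itv (false :: s))
    (fun x => (f (path_from n (false :: s) x))%:E)); last first.
    move=> x; rewrite inE /node_itv /= in_itv/= mul0r addr0 mul1r => /andP[_ h].
    by have /negbTE -> : ~~ (node_left s + 2 ^- (size s).+2 <= x) by rewrite -ltNge.
  rewrite (@eq_integral _ _ _ leb (node_itv (true :: s))
    (fun x => (f (path_from n (true :: s) x))%:E)); last first.
    by move=> x; rewrite inE /node_itv /= in_itv/= mul1r => /andP[-> _].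
  rewrite !IH -EFinD /avg /=; congr EFin.
  have -> : 2 ^- (size s).+2 = 2 ^- (size s).+1 / 2 :> R by rewrite exprSr invfM.
  lra.
- apply: measurable_funTS; apply/measurable_EFinP.
  exact: (measurable_path_from f n.+1 s).
- by move=> x _; rewrite lee_fin.
Qed.

Definition dyadic_path n x := path_from n [::] x.

Lemma dyadic_pathD n k f x :
  `|f (dyadic_path (n + k) x) - f (dyadic_path n x)| =
  `|f (dyadic_path (n + k) x) - f (drop k (dyadic_path (n + k) x))|.
Proof. by rewrite /dyadic_path path_fromD drop_path_from. Qed.

Local Notation base := (node_itv [::]).

Lemma integral_dyadic_path f n : (forall t, 0 <= f t) ->
  (\int[leb]_(x in base) (2 * f (dyadic_path n x))%:E = (iter n avg f [::])%:E)%E.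
Proof.
move=> f0; rewrite (@integral_path_from (fun t => 2 * f t) n [::]); last first.
  by move=> t; rewrite mulr_ge0.
under eq_fun do rewrite -[_ * _]addr0.
by rewrite avgn_lin avgn_cst addr0 mulrA /= expr1 mulVf// mul1r.
Qed.

Lemma measurable_dyadic_path f n :
  measurable_fun setT (fun x => f (dyadic_path n x)).
Proof. exact: measurable_path_from. Qed.

(** The step functions of a bounded martingale are Cauchy in L^1; a subsequence
    with summable distances converges almost everywhere, and by domination
    also in L^1. *)
Lemma martingale_density f C : martingale f -> (forall t, `|f t| <= C) ->
  exists F : R -> R, [/\ measurable_fun setT F, forall x, `|F x| <= C &
    forall e : R, 0 < e -> exists N, forall n, (N <= n)%N ->
    (\int[leb]_(x in base) (`|f (dyadic_path n x) - F x|)%:E <= e%:E)%E].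
Proof.
move=> mf fC.
pose D n k := (\int[leb]_(x in base)
  (2 * `|f (dyadic_path (n + k) x) - f (dyadic_path n x)|)%:E)%E.
have DE n k : D n k =
    (iter (n + k) avg (fun t => `|f t - f (drop k t)|) [::])%:E.
  rewrite -integral_dyadic_path//; apply: eq_integral => x _.
  by rewrite dyadic_pathD.
pose err j : R := 2 / (2 ^ j.+1)%:R.
have err_gt0 j : 0 < err j by rewrite divr_gt0// ltr0n expn_gt0.
have /choice[N NP] : forall j : nat, exists N : nat, forall n k, (N <= n)%N ->
    (D n k <= (err j)%:E)%E.
  move=> j; have [N NP] := martingale_cauchy mf fC (err_gt0 j).
  by exists N => n k Nn; rewrite DE lee_fin NP.
(* Partial sums of the thresholds, to have a nondecreasing subsequence. *)
pose p j := (\sum_(i < j.+1) N i)%N.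
have pN j : (N j <= p j)%N by rewrite /p big_ord_recr leq_addl.
pose d j := (p j.+1 - p j)%N.
have pS j : p j.+1 = (p j + d j)%N.
  by rewrite /d subnKC// /p [in leqRHS]big_ord_recr leq_addr.
pose s j x := f (dyadic_path (p j) x).
pose u x : R ^nat := fun j => s j.+1 x - s j x.
have mu_ j : measurable_fun setT (fun x => (2 * `|u x j|)%:E).
  apply/measurable_EFinP; apply: measurable_funM => //.
  apply: measurableT_comp => //; apply: measurable_funB; exact: measurable_dyadic_path.
have u0 j x : (0 <= (2 * `|u x j|)%:E)%E by rewrite lee_fin mulr_ge0.
pose g x := (\sum_(j <oo) (2 * `|u x j|)%:E)%E.
have g0 x : (0 <= g x)%E by apply: nneseries_ge0.
have mg : measurable_fun base g.
  by apply: ge0_emeasurable_sum => // j _; exact: measurable_funTS.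
have intg : leb.-integrable base g.
  apply/integrableP; split => //.
  under eq_integral do rewrite gee0_abs//.
  rewrite /g integral_nneseries; last 3 first.
  - exact: measurable_node_itv.
  - by move=> j; apply: measurable_funTS; exact: mu_.
  - by move=> j x _; exact: u0.
  apply: (@le_lt_trans _ _ (\sum_(j <oo) (err j)%:E)%E).
    apply: lee_nneseries => // [j _ _|j _]; first exact: integral_ge0.
    by have := NP j _ (d j) (pN j); rewrite /D -pS.
  by apply: le_lt_trans (epsilon_trick0 xpredT _) _ => //; exact: ltry.
have ucvg : {ae leb, forall x, base x -> cvgn (s ^~ x)}.
  have := @integrable_ae _ _ _ leb _ (measurable_node_itv [::]) _ intg.
  apply: filterS => x /[apply] gx.
  have -> : s ^~ x = fun j => s 0%N x + series (u x) j.
    by apply/funext => j; rewrite (eq_sum_telescope (s ^~ x)).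
  apply: is_cvgD; first exact: is_cvg_cst.
  apply: normed_cvg.
  rewrite -[X in cvgn X]/(series (fun k => `|u x k|)).
  apply: nondecreasing_is_cvgn.
    apply/nondecreasing_seqP => j.
    by rewrite seriesS lerDr /=.
  exists (fine (g x)) => _ [j _ <-]; rewrite -lee_fin fineK//.
  apply: le_trans (nneseries_lim_ge j _) => //.
  rewrite sumEFin lee_fin; apply: ler_sum => i _.
  by rewrite ler_peMl// ler1n.
have C0 : 0 <= C by exact: le_trans (fC [::]).
pose F0 x := fine (limn_esup (fun j => (s j x)%:E)).
have mF0 : measurable_fun setT F0.
  apply: measurableT_comp => //; apply: measurable_fun_limn_esup => j.
  by apply/measurable_EFinP; exact: measurable_dyadic_path.
(* The upper limit is truncated so as to be bounded everywhere and not only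
   where the subsequence converges. *)
pose F x := Num.max (- C) (Num.min (F0 x) C).
have mF : measurable_fun setT F.
  apply: measurable_maxr; first exact: measurable_cst.
  by apply: measurable_minr => //; exact: measurable_cst.
have F0E x : `|F0 x| <= C -> F x = F0 x.
  by rewrite ler_norml /F => /andP[h1 h2]; rewrite min_l// max_r.
exists F; split => //.
  by move=> x; rewrite ler_norml le_max lexx/= ge_max ge_min lexx orbT; lra.
have [|||||_ + _] := @dominated_convergence _ _ _ leb base (measurable_node_itv _)
    (fun j x => (s j x)%:E) (EFin \o F) (cst C%:E).
- by move=> j; apply: measurable_funTS; apply/measurable_EFinP; exact: measurable_dyadic_path.
- by apply: measurable_funTS; apply/measurable_EFinP.
- apply: filterS ucvg => x + bx => /(_ bx) /cvg_ex[l sl].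
  have esl : (fun j => (s j x)%:E) @ \oo --> l%:E by apply/cvg_EFin => //; exact: nearW.
  have F0l : F0 x = l.
    by rewrite /F0 is_cvg_limn_esupE ?(cvg_lim _ esl)//=; exact: (cvgP _ esl).
  rewrite /= F0E F0l//.
  have h : `|s j x| @[j --> \oo] --> `|l| by exact: cvg_norm.
  rewrite -(cvg_lim (@Rhausdorff R) h); apply: limr_le; first exact: cvgP h.
  by apply: nearW => j; exact: fC.
- apply/integrableP; split; first exact: measurable_cst.
  rewrite (@integral_cst _ _ _ leb _ (measurable_node_itv [::]) `|C%:E|%E).
  apply: lte_mul_pinfty => //.
  by apply: le_lt_trans (ltry (2 ^- 1)); rewrite le_eqVlt; apply/orP; left;
    apply/eqP; exact: (measure_node_itv [::]).
- by apply: nearW => x j _; rewrite lee_fin fC.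
move=> scvg.
pose a n := (\int[leb]_(x in base) (`|f (dyadic_path n x) - F x|)%:E)%E.
have a0 n : (0 <= a n)%E by apply: integral_ge0.
have {}scvg : a (p j) @[j --> \oo] --> 0%E.
  by apply: cvg_trans scvg; apply: near_eq_cvg; apply: nearW => j.
have a_le j n : (p j <= n)%N -> (a n <= (err j)%:E + a (p j))%E.
  move=> pjn; have := NP j _ (n - p j)%N (pN j); rewrite /D subnKC// => h.
  apply: (le_trans _ (leeD2r _ h)).
  have mdF m : measurable_fun base (fun x => (`|f (dyadic_path m x) - F x|)%:E).
    apply: measurable_funTS; apply/measurable_EFinP; apply: measurableT_comp => //.
    by apply: measurable_funB => //; exact: measurable_dyadic_path.
  have md2 : measurable_fun base
      (fun x => (2 * `|f (dyadic_path n x) - f (dyadic_path (p j) x)|)%:E).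
    apply: measurable_funTS; apply/measurable_EFinP; apply: measurable_funM => //.
    apply: measurableT_comp => //.
    by apply: measurable_funB; exact: measurable_dyadic_path.
  rewrite -ge0_integralD//; [|exact: measurable_node_itv|exact: mdF].
  apply: ge0_le_integral => //.
  - exact: measurable_node_itv.
  - exact: mdF.
  - by apply: emeasurable_funD => //; exact: mdF.
  - move=> x _; rewrite -EFinD lee_fin.
    rewrite -(subrKA (f (dyadic_path (p j) x))) (le_trans (ler_normD _ _))//.
    by rewrite lerD2r ler_peMl// ler1n.
move=> e e0.
have e20 : 0 < e / 2 by rewrite divr_gt0.
have err0 : err @ \oo --> 0.
  rewrite (_ : err = fun j => (2^-1) ^+ j).
    by apply: cvg_expr; rewrite ger0_norm ?invr_ge0// invf_lt1// ltr1n.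
  apply/funext => j.
  by rewrite /err natrX exprS invfM mulrA mulfV ?pnatr_eq0// mul1r exprVn.
move: scvg err0 => /fine_cvgP[afin /cvgrPdist_le/(_ _ e20) afine].
move=> /cvgrPdist_le/(_ _ e20) err0.
have [j [[/= aj aje] errj]] := filter_ex (filterI (filterI afin afine) err0).
exists (p j) => n /a_le/le_trans; apply.
rewrite -(fineK aj) -EFinD lee_fin; move: aje errj; rewrite !sub0r !normrN.
move=> /(le_trans (ler_norm _)) + /(le_trans (ler_norm _)); rewrite /=; lra.
Qed.

End DyadicPaths.

(** * Classes of functions and weighted integral norms *)

Section ClassesOfFunctions.
Context d (T : measurableType d) (R : realType).
Variable mu : {measure set T -> \bar R}.
#[local] Hint Extern 0 (Filter (nbhs (almost_everywhere _))) =>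
  (exact: (ae_filter_ringOfSetsType mu)) : typeclass_instances.

(** The class of g when g is measurable; total so that it applies without a
    proof of measurability. *)
Definition toL0 (g : T -> R) : L0 mu :=
  xget 0 [set f : L0 mu | \forall x \ae mu, f x = g x].

Lemma toL0E g : measurable_fun setT g -> \forall x \ae mu, toL0 g x = g x.
Proof.
move=> mg; pose g' : {mfun T >-> R} := HB.pack g
  (isMeasurableFun.Build _ _ _ _ g mg).
rewrite /toL0; case: xgetP => [h _ //|/(_ (classL0 mu g'))[]].
exact: classL0E.
Qed.

Lemma toL0_lin (a b : R) f g : measurable_fun setT f -> measurable_fun setT g ->
  toL0 (fun x => a * f x + b * g x) = a *: toL0 f + b *: toL0 g.
Proof.
move=> mf mg; apply/L0P.
have mfg : measurable_fun setT (fun x => a * f x + b * g x).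
  by apply: measurable_funD; apply: measurable_funM.
near=> x.
have -> : toL0 (fun x => a * f x + b * g x) x = a * f x + b * g x.
  by near: x; exact: toL0E.
have -> : (a *: toL0 f + b *: toL0 g : L0 mu) x =
   (a *: toL0 f : L0 mu) x + (b *: toL0 g : L0 mu) x by near: x; exact: L0D.
have -> : (a *: toL0 f : L0 mu) x = a * toL0 f x by near: x; exact: L0Z.
have -> : (b *: toL0 g : L0 mu) x = b * toL0 g x by near: x; exact: L0Z.
have -> : toL0 f x = f x by near: x; exact: toL0E.
by have -> : toL0 g x = g x by near: x; exact: toL0E.
Unshelve. all: by end_near. Qed.

Definition embed (A : normed_subspace (L0 mu)) (g : T -> R) : fspace A :=
  insubd 0 (toL0 g).

Lemma val_embed (A : normed_subspace (L0 mu)) g :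
  carrier A (toL0 g) -> val (embed A g) = toL0 g.
Proof. by move=> Ag; rewrite insubdK//; exact/mem_set. Qed.

Lemma norm_embed (A : normed_subspace (L0 mu)) g :
  carrier A (toL0 g) -> `|embed A g| = fnorm A (toL0 g).
Proof. by move=> Ag; rewrite fspace_normE val_embed. Qed.

Lemma embed_lin (A : normed_subspace (L0 mu)) (a b : R) f g :
  measurable_fun setT f -> measurable_fun setT g ->
  carrier A (toL0 f) -> carrier A (toL0 g) ->
  embed A (fun x => a * f x + b * g x) = a *: embed A f + b *: embed A g.
Proof.
move=> mf mg Af Ag; apply: val_inj.
have valZ c (x : fspace A) : val (c *: x) = c *: val x by exact: linearZ.
have valD (x y : fspace A) : val (x + y) = val x + val y by exact: raddfD.
rewrite valD !valZ !val_embed//; first exact: toL0_lin.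
by rewrite toL0_lin//; apply: carrierD; exact: carrierZ.
Qed.

Lemma absop_ae (op : abs_operator mu) f g : measurable_fun setT f ->
  measurable_fun setT g -> (\forall x \ae mu, f x = g x) ->
  \forall x \ae mu, op f x = op g x.
Proof.
move=> mf mg fg.
have le h k : measurable_fun setT h -> measurable_fun setT k ->
    (\forall x \ae mu, h x = k x) -> \forall x \ae mu, (op h x <= op k x)%E.
  move=> mh mk hk.
  have : \forall x \ae mu, (op h x <= 1%:E * op k x + 0%:E * op k x)%E.
    apply: absop_le => //; apply: filterS hk => x ->.
    by rewrite mul1r mul0r addr0.
  by apply: filterS => x; rewrite mul1e mul0e adde0.
have gf : \forall x \ae mu, g x = f x by apply: filterS fg => x.
near=> x; apply/eqP; rewrite eq_le; apply/andP; split; near: x; exact: le.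
Unshelve. all: by end_near. Qed.

End ClassesOfFunctions.

Section WeightedL1.
Context {R : realType}.
Local Notation leb := (@lebesgue_measure R).
Local Notation base := (node_itv [::] : set R).
#[local] Hint Extern 0 (Filter (nbhs (almost_everywhere _))) =>
  (exact: (ae_filter_ringOfSetsType leb)) : typeclass_instances.
Variables (I : base_itv) (A : normed_subspace (L0 (@lebesgue_on R I))).
Variable w : R -> R.
Hypothesis mw : measurable_fun setT w.
Hypothesis w_gt0 : forall x, base x -> 0 < w x.
Hypothesis normA : forall g : R -> R, measurable_fun setT g ->
  (forall x, ~ base x -> g x = 0) ->
  (\int[leb]_(x in base) (`|g x| * w x)%:E < +oo)%E ->
  carrier A (toL0 (lebesgue_on I) g) /\
  (fnorm A (toL0 (lebesgue_on I) g))%:E =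
    (\int[leb]_(x in base) (`|g x| * w x)%:E)%E.

(** The factor 2 normalizes Lebesgue measure on the root interval, of length
    1/2. *)
Let scaled (h : R -> R) x : R := 2 * h x * \1_base x / w x.

(** A space of functions, closed under linear combinations, on which everything
    is integrable against the weight. *)
Let good (h : R -> R) :=
  measurable_fun setT h /\ exists C, forall x, `|h x| <= C.

Let measurable_scaled h : measurable_fun setT h -> measurable_fun setT (scaled h).
Proof.
move=> mh; apply: measurable_funM.
  apply: measurable_funM; first exact: measurable_funM.
  exact: (measurable_indic (measurable_node_itv [::])).
by apply: measurableT_comp => //; exact: measurable_invr.
Qed.

Let integral_scaled h : (\int[leb]_(x in base) (`|scaled h x| * w x)%:E =
  \int[leb]_(x in base) (2 * `|h x|)%:E)%E.
Proof.
apply: eq_integral => x bx; have wx := w_gt0 (set_mem bx).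
rewrite /scaled indicE bx mulr1 !normrM normfV (ger0_norm (ler0n _ 2)).
by rewrite (gtr0_norm wx) divfK// gt_eqF.
Qed.

Let emb h : fspace A := embed A (scaled h).

Let embP h : good h -> carrier A (toL0 (lebesgue_on I) (scaled h)) /\
  (`|emb h|%:E = \int[leb]_(x in base) (2 * `|h x|)%:E)%E.
Proof.
move=> [mh [C hC]].
have [||Ah nh] := normA (measurable_scaled mh).
- by move=> x bx; rewrite /scaled indicE memNset// mulr0 mul0r.
- rewrite integral_scaled.
  apply: (@le_lt_trans _ _ (\int[leb]_(x in base) (2 * C)%:E)%E).
    apply: ge0_le_integral => //.
    + exact: measurable_node_itv.
    + apply: measurable_funTS; apply/measurable_EFinP; apply: measurable_funM => //.
      exact: measurableT_comp.
    + by move=> x _; rewrite lee_fin ler_pM2l.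
  rewrite (@integral_cst _ _ _ leb _ (measurable_node_itv [::]) (2 * C)%:E).
  apply: lte_mul_pinfty => //.
    by rewrite lee_fin mulr_ge0// (le_trans _ (hC 0)).
  by apply: le_lt_trans (ltry (2 ^- 1)); rewrite le_eqVlt; apply/orP; left;
    apply/eqP; exact: (measure_node_itv [::]).
by split => //; rewrite norm_embed// nh integral_scaled.
Qed.

Let emb_lin a b h k : good h -> good k ->
  emb (fun x => a * h x + b * k x) = a *: emb h + b *: emb k.
Proof.
move=> gh gk; have [[mh _] [mk _]] := (gh, gk).
rewrite /emb -embed_lin; try exact: measurable_scaled; try exact: (embP _).1.
by congr embed; apply/funext => x; rewrite /scaled; ring.
Qed.

Let good_lin a b h k : good h -> good k -> good (fun x => a * h x + b * k x).
Proof.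
move=> [mh [C hC]] [mk [D kD]]; split.
  by apply: measurable_funD; apply: measurable_funM.
exists (`|a| * C + `|b| * D) => x; rewrite (le_trans (ler_normD _ _))// !normrM.
by rewrite lerD// ler_wpM2l.
Qed.

Let good_path (f : seq bool -> R) n s : good (fun x => f (path_from n s x)).
Proof.
split; first exact: measurable_path_from.
elim: n s => [|n IH] s; first by exists `|f s|.
have [[C fC] [D fD]] := (IH (true :: s), IH (false :: s)).
exists (Num.max C D) => x /=; rewrite le_max.
by case: (_ <= x); rewrite ?fC// fD orbT.
Qed.

Let good_mul h k : good h -> good k -> good (fun x => h x * k x).
Proof.
move=> [mh [C hC]] [mk [D kD]]; split; first exact: measurable_funM.
by exists (C * D) => x; rewrite normrM ler_pM.
Qed.

Let atom s (x : R) : R := 2 ^+ size s * \1_(node_itv s) x.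

Let good_atom s : good (atom s).
Proof.
split.
  apply: measurable_funM => //.
  exact: (measurable_indic (measurable_node_itv s)).
exists (2 ^+ size s) => x; rewrite /atom normrM ger0_norm ?exprn_ge0//.
by rewrite ler_piMr ?exprn_ge0// indicE; case: (_ \in _); rewrite ?normr0 ?normr1.
Qed.

Let v s : fspace A := emb (atom s).

(** At each point x of the interval of s exactly one child survives, the one on
    the path of x, with twice the weight. *)
Let atom_avg n f s x : 2^-1 * (atom (false :: s) x * f (path_from n (false :: s) x)) +
  2^-1 * (atom (true :: s) x * f (path_from n (true :: s) x)) =
  atom s x * f (path_from n.+1 s x) :> R.
Proof.
have [e /disj_setPS dis] := node_itv_split (R := R) s.
rewrite /atom /= !indicE e in_setU exprS.
have [x0|x0] := boolP (x \in node_itv (false :: s)).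
  have x1 : x \in node_itv (true :: s) = false.
    by apply/negbTE/negP => /set_mem x1; apply: (dis x); split => //; exact: set_mem.
  have -> : (node_left s + 1 * 2 ^- (size s).+2 <= x) = false.
    apply/negbTE; rewrite -ltNge; move: x0; rewrite inE /node_itv /= in_itv/=.
    by rewrite mul0r addr0 mul1r => /andP[].
  by rewrite x1/=; field.
have [x1|x1] := boolP (x \in node_itv (true :: s)); last by rewrite /=; ring.
have -> : (node_left s + 1 * 2 ^- (size s).+2 <= x).
  by move: x1; rewrite inE /node_itv /= in_itv/= => /andP[].
by rewrite /=; field.
Qed.

Let tree_sumE f n : tree_sum v f n = emb (fun x => f (dyadic_path n x)).
Proof.
have -> : emb (fun x => f (dyadic_path n x)) =
    emb (fun x => atom [::] x * f (path_from n [::] x)).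
  rewrite /emb; congr embed; apply/funext => x; rewrite /scaled /atom expr0 mul1r.
  rewrite indicE; case: (_ \in _); rewrite ?mul1r// !mulr0//.
rewrite /tree_sum; elim: n [::] => [|n IH] s /=.
  have -> : (fun x => atom s x * f s) = fun x => f s * atom s x + 0 * atom s x.
    by apply/funext => x; ring.
  by rewrite emb_lin// scale0r addr0.
rewrite /vavg !IH scalerDr -emb_lin; [|exact: good_mul..].
by congr emb; apply/funext => x; exact: atom_avg.
Qed.

(** Division by w maps the normalized L^1 space of the root interval
    isometrically into the space, so the normalized indicators of dyadic
    intervals form the tree and the densities of martingales are the limits. *)
Theorem weighted_L1_not_wfpp : ~ wfpp (fspace A).
Proof.
apply: (@dyadic_tree_not_wfpp _ _ v).
- apply/funext => s; rewrite /vavg /v scalerDr -emb_lin//; congr emb.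
  apply/funext => x; have := atom_avg 0 (fun=> 1) s x; rewrite !mulr1 => <-.
  by [].
- move=> n f; rewrite tree_sumE; apply: EFin_inj.
  rewrite (embP (good_path f n [::])).2.
  exact: (integral_dyadic_path (f := fun t => `|f t|)).
- move=> f [mf _ f02].
  have f2 s : `|f s| <= 2 by have /andP[f0 f2] := f02 s; rewrite ger0_norm.
  have [F [mF F2 Fcvg]] := martingale_density mf f2.
  have gF : good F by split => //; exists 2.
  apply: (cvgP (emb F)); apply/cvgrPdist_le => e e0.
  have [|N NP] := Fcvg (e / 2); first by rewrite divr_gt0.
  exists N => // n /= Nn; rewrite distrC tree_sumE.
  rewrite -[emb (fun x => _)]scale1r -scaleN1r -emb_lin//; last exact: good_path.
  rewrite -lee_fin (embP _).2; last by apply: good_lin => //; exact: good_path.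
  under eq_integral do rewrite mul1r mulN1r EFinM.
  rewrite ge0_integralZl_EFin//; last 2 first.
  - exact: measurable_node_itv.
  - apply: measurable_funTS; apply/measurable_EFinP; apply: measurableT_comp => //.
    by apply: measurable_funB => //; exact: measurable_dyadic_path.
  have := NP _ Nn; rewrite -(@lee_pmul2l _ 2%:E)// => /le_trans; apply.
  by rewrite -EFinM lee_fin; lra.
Qed.

End WeightedL1.

(** * Norms in the derived spaces *)

Section DerivedNorms.
Context d (T : measurableType d) (R : realType).
Variable mu : {measure set T -> \bar R}.
#[local] Hint Extern 0 (Filter (nbhs (almost_everywhere _))) =>
  (exact: (ae_filter_ringOfSetsType mu)) : typeclass_instances.
Implicit Types (op : abs_operator mu) (X : ideal_space mu).

(** The norm of g in a derived space is only seen through T|g|, so the ideal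
    property lets one compare it with multiples of an element chi of X. *)
Lemma derived_upper X op (g : T -> R) (chi : L0 mu) (B : R) :
  measurable_fun setT g -> carrier X chi -> 0 <= B ->
  (\forall x \ae mu, (op g x <= (B * `|chi x|)%:E)%E) ->
  carrier (derived X op) (toL0 mu g) /\
  fnorm (derived X op) (toL0 mu g) <= B * fnorm X chi.
Proof.
move=> mg Xchi B0 opB; have mg' := measurable_L0 (toL0 mu g).
have opE := absop_ae op mg' mg (toL0E mu mg).
have op0 := absop_ge0 op mg.
have mu_ : measurable_fun setT (fine \o op g).
  by apply: measurableT_comp => //; exact: measurable_absop.
have uE := toL0E mu mu_; set u := toL0 mu (fine \o op g) in uE.
have BchiE := L0Z B chi.
have ufin : represents mu (op g) u.
  rewrite /represents; near=> x.
  have -> : u x = (fine \o op g) x by near: x.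
  rewrite /= fineK// ge0_fin_numE; last by near: x.
  by apply: (@le_lt_trans _ _ (B * `|chi x|)%:E); [near: x|exact: ltry].
have urep : represents mu (op (toL0 mu g)) u.
  rewrite /represents; near=> x.
  have -> : op (toL0 mu g) x = op g x by near: x.
  by near: x; exact: ufin.
have [|Xu nu] := @idealP _ _ _ _ X u (B *: chi) (carrierZ B Xchi).
  near=> x.
  have -> : (B *: chi : L0 mu) x = B * chi x by near: x.
  rewrite normrM (ger0_norm B0) -lee_fin.
  have ux : op g x = (u x)%:E by near: x; exact: ufin.
  have u0 : 0 <= u x by rewrite -lee_fin -ux; near: x.
  by rewrite (ger0_norm u0) -ux; near: x.
split; first by exists u.
by rewrite /= (derived_fnormE X urep) (le_trans nu)// fnormZ// ger0_norm.
Unshelve. all: by end_near. Qed.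

Lemma derived_lower X op (g : T -> R) (chi : L0 mu) (B : R) :
  measurable_fun setT g -> carrier X chi -> 0 <= B ->
  (\forall x \ae mu, ((B * `|chi x|)%:E <= op g x)%E) ->
  carrier (derived X op) (toL0 mu g) ->
  B * fnorm X chi <= fnorm (derived X op) (toL0 mu g).
Proof.
move=> mg Xchi B0 opB [u urep Xu]; have mg' := measurable_L0 (toL0 mu g).
have opE := absop_ae op mg' mg (toL0E mu mg).
rewrite /= (derived_fnormE X urep) -(ger0_norm B0) -fnormZ//.
have BchiE := L0Z B chi.
have [] // := @idealP _ _ _ _ X (B *: chi) u Xu.
near=> x.
have -> : (B *: chi : L0 mu) x = B * chi x by near: x.
rewrite normrM (ger0_norm B0) (le_trans _ (ler_norm _))// -lee_fin.
have <- : op (toL0 mu g) x = (u x)%:E by near: x.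
have -> : op (toL0 mu g) x = op g x by near: x.
by near: x.
Unshelve. all: by end_near. Qed.

Lemma Linfty_indic (S : set T) : measurable S -> (0 < mu S)%E ->
  carrier (Lp mu (leey 1)) (toL0 mu \1_S) /\
  fnorm (Lp mu (leey 1)) (toL0 mu \1_S) = 1.
Proof.
move=> mS S0.
have mI : measurable_fun setT (\1_S : T -> R) by exact: measurable_indic.
have IE := toL0E mu mI.
suff nE : ('N[mu]_+oo[EFin \o (toL0 mu \1_S : T -> R)] = 1)%E.
  by split; rewrite /= ?/Lp_carrier/= ?/finite_norm /Lp_fnorm ?nE ?ltry.
have mT : (0 < mu setT)%E.
  by apply: (lt_le_trans S0); apply: le_measure; rewrite ?inE.
rewrite unlock mT (@eq_ess_sup _ _ _ _ _ (fun x => (\1_S x)%:E)); last first.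
  by apply: filterS IE => x /= ->; rewrite ger0_norm.
apply/eqP; rewrite eq_le; apply/andP; split.
  apply/ess_supP; apply: nearW => x; rewrite lee_fin indicE.
  by case: (_ \in _).
rewrite leNgt; apply/negP => lt1.
have := ess_sup_ge mu (fun x => (\1_S x)%:E) => -[N [mN N0 sN]].
move: S0; rewrite ltNge => /negP; apply; rewrite -N0.
apply: le_measure; rewrite ?inE// => x Sx; apply: sN => /= h.
by have := le_lt_trans h lt1; rewrite indicE mem_set// ltxx.
Qed.

Lemma derived_L1 op (g : T -> R) : measurable_fun setT g ->
  (\int[mu]_x op g x < +oo)%E ->
  carrier (derived (Lp mu (lexx 1%E)) op) (toL0 mu g) /\
  ((fnorm (derived (Lp mu (lexx 1%E)) op) (toL0 mu g))%:E = \int[mu]_x op g x)%E.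
Proof.
move=> mg intg; have mg' := measurable_L0 (toL0 mu g).
have opE := absop_ae op mg' mg (toL0E mu mg).
have op0 := absop_ge0 op mg.
have mop := measurable_absop op mg.
have mu_ : measurable_fun setT (fine \o op g) by exact: measurableT_comp.
have uE := toL0E mu mu_; set u := toL0 mu (fine \o op g) in uE.
have absE : ae_eq mu setT (abse \o op g) (op g).
  by apply: filterS op0 => x x0 _ /=; rewrite gee0_abs.
have iabs : (\int[mu]_x `|op g x| = \int[mu]_x op g x)%E.
  by apply: ae_eq_integral => //; exact: measurableT_comp.
have iop : mu.-integrable setT (op g) by apply/integrableP; split; rewrite ?iabs.
have opfin := integrable_ae measurableT iop.
have ufin : represents mu (op g) u.
  rewrite /represents; near=> x.
  have -> : u x = (fine \o op g) x by near: x.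
  rewrite /= fineK//; have : setT x -> op g x \is a fin_num by near: x.
  exact.
have urep : represents mu (op (toL0 mu g)) u.
  rewrite /represents; near=> x.
  have -> : op (toL0 mu g) x = op g x by near: x.
  by near: x; exact: ufin.
have nE : ('N[mu]_1[EFin \o (u : T -> R)] = \int[mu]_x op g x)%E.
  rewrite Lnorm1 -iabs; apply: ae_eq_integral => //.
  - apply: measurableT_comp => //; apply/measurable_EFinP; exact: measurable_L0.
  - exact: measurableT_comp.
  - by apply: filterS ufin => x -> _.
have Xu : carrier (Lp mu (lexx 1%E)) u.
  by rewrite /= /Lp_carrier/= /finite_norm nE.
split; first by exists u.
rewrite /= (derived_fnormE _ urep) /= /Lp_fnorm nE fineK// -iabs.
by rewrite ge0_fin_numE; [rewrite iabs | exact: integral_ge0].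
Unshelve. all: by end_near. Qed.

End DerivedNorms.

Section RestrictedMeasure.
Context {R : realType}.
Local Notation leb := (@lebesgue_measure R).

Lemma integral_lebesgue_on I (h : R -> \bar R) : measurable_fun setT h ->
  (forall x, (0 <= h x)%E) ->
  (\int[lebesgue_on I]_x h x = \int[leb]_(x in [set` itv_of I]) h x)%E.
Proof.
move=> mh h0.
rewrite (@ge0_negligible_integral _ _ _ (lebesgue_on I) setT (~` [set` itv_of I])).
- rewrite setTD setCK; apply: eq_measure_integral => A mA AI.
  by rewrite /lebesgue_on /= /mrestr setIidl.
- exact: measurableC.
- by [].
- exact: mh.
- by move=> x _; exact: h0.
by rewrite /lebesgue_on /= /mrestr setICl measure0.
Qed.

End RestrictedMeasure.

(** * The Copson space of bounded functions *)

Section L1Type.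
Context {R : realType}.
Local Notation leb := (@lebesgue_measure R).
Local Notation base := (node_itv [::] : set R).
#[local] Hint Extern 0 (Filter (nbhs (almost_everywhere _))) =>
  (exact: (ae_filter_ringOfSetsType leb)) : typeclass_instances.
Implicit Types (I : base_itv) (x t : R) (g : R -> R).

Lemma baseE x : base x <-> 2^-1 <= x < 1.
Proof.
rewrite /node_itv /= in_itv/= expr1.
by have -> : 2^-1 + 2^-1 = 1 :> R by lra.
Qed.

Lemma base_itv_of I x : base x -> [set` itv_of I] x.
Proof. by move=> /baseE bx; case: I; rewrite /= in_itv/=; lra. Qed.

Lemma measurable_norm_mul g w : measurable_fun setT g -> measurable_fun setT w ->
  measurable_fun setT (fun t => (`|g t| * w t)%:E).
Proof.
move=> mg mw; apply/measurable_EFinP; apply: measurable_funM => //.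
exact: measurableT_comp.
Qed.

Lemma integral_support (D : set R) (f : R -> \bar R) :
  (forall t, ~ base t -> f t = 0%E) ->
  (\int[leb]_(t in D) f t = \int[leb]_(t in D `&` base) f t)%E.
Proof.
move=> f0; rewrite integral_mkcond [RHS]integral_mkcond; apply: eq_integral => t _.
rewrite !patchE in_setI; case: (t \in D) => //=.
by have [//|/negP tb] := boolP (t \in base); rewrite f0// => /mem_set.
Qed.

Lemma lebesgue_on_gt0 I (S : set R) a b : measurable S -> 0 <= a -> a < b ->
  [set` itv_of I] b -> `]a, b[%classic `<=` S -> (0 < lebesgue_on I S)%E.
Proof.
move=> mS a0 ab Ib abS.
have : (leb `]a, b[%classic <= leb (S `&` [set` itv_of I]))%E.
  apply: le_measure; rewrite ?inE//; first exact: measurableI.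
  move=> x abx; split; first exact: abS.
  move: abx; rewrite /= in_itv/= => /andP[ax xb]; apply: itv_of_sub Ib.
  by rewrite (le_trans a0 (ltW ax)) ltW.
apply: lt_le_trans.
by rewrite lebesgue_measure_itv/= lte_fin ab -EFinD lte_fin subr_gt0.
Qed.

Lemma itv_of_le1 I x : 0 <= x <= 1 -> [set` itv_of I] x.
Proof. by move=> /andP[x0 x1]; case: I; rewrite /= in_itv/= x0 ?x1. Qed.

Lemma ae_on_indic I (S : set R) (P : R -> R -> Prop) : measurable S ->
  (\forall x \ae leb, [set` itv_of I] x -> P x (\1_S x)) ->
  \forall x \ae lebesgue_on I, P x (toL0 (lebesgue_on I) \1_S x).
Proof.
move=> mS PS; have /ae_restr SE := toL0E (lebesgue_on I) (measurable_indic mS).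
apply/ae_restr; apply: filterS2 SE PS => x SE PS Ix.
by rewrite SE//; exact: PS.
Qed.


(** The Copson transform of |g| is nonincreasing and, for g supported in
    [1/2, 1[, constant on [0, 1/2], where it is the integral of |g(t)| / t. *)
Theorem Cop_oo_not_wfpp I : ~ wfpp (Cop_oo R I).
Proof.
refine (@weighted_L1_not_wfpp R I
  (CopsonSpace (Lp (lebesgue_on I) (leey 1))) (fun t => t^-1) _ _ _).
- exact: measurable_invr.
- by move=> x /baseE; rewrite invr_gt0; lra.
move=> g mg g0 gfin.
set V := (\int[leb]_(x in base) _)%E in gfin *.
have mgV := measurable_norm_mul mg (@measurable_invr R).
have gV0 t : ~ base t -> (`|g t| / t)%:E = 0%E by move=> /g0 ->; rewrite normr0 mul0r.
have gVge0 t : base t -> (0 <= (`|g t| / t)%:E)%E.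
  by move=> /baseE bt; rewrite lee_fin divr_ge0//; lra.
have V0 : (0 <= V)%E by exact: integral_ge0.
have VE : ((fine V)%:E = V)%E by rewrite fineK// ge0_fin_numE.
have copV x : (Copson I (fun t => `|g t|)%R x <= V)%E.
  rewrite /Copson integral_support//; apply: ge0_subset_integral => //.
  - by apply: measurableI; [exact: measurable_itv_tail | exact: measurable_node_itv].
  - exact: measurable_node_itv.
  - exact: measurable_funTS.
have copVE x : x <= 2^-1 -> (Copson I (fun t => `|g t|)%R x = V).
  move=> x2; rewrite /Copson integral_support//; congr (integral _ _ _).
  apply/seteqP; split => [t []//|t bt]; split => //; split.
    exact: base_itv_of.
  by move/baseE: bt; rewrite /= in_itv/= andbT; lra.
pose S := `[0, 2^-1]%classic : set R.
have mS : measurable S by exact: measurable_itv.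
have mI : measurable ([set` itv_of I] : set R) by exact: measurable_itv.
have I_gt0 : (0 < lebesgue_on I ([set` itv_of I] : set R))%E.
  apply: (@lebesgue_on_gt0 _ _ 0 1) => //.
    by apply: itv_of_le1; rewrite ler01 lexx.
  by move=> x /=; rewrite in_itv/= => x01; apply: itv_of_le1; lra.
have S_gt0 : (0 < lebesgue_on I S)%E.
  apply: (@lebesgue_on_gt0 _ _ 0 2^-1) => //.
  - by apply: itv_of_le1; lra.
  - by move=> x /=; rewrite /S /= !in_itv/=; lra.
have [cI nI] := @Linfty_indic _ (measurableTypeR R) R (lebesgue_on I) _ mI I_gt0.
have [cS nS] := @Linfty_indic _ (measurableTypeR R) R (lebesgue_on I) _ mS S_gt0.
have fV0 : 0 <= fine V by exact: fine_ge0.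
have [|cg ng] := @derived_upper _ _ _ (lebesgue_on I) _ (copson_operator I) g _ (fine V) mg cI fV0.
  apply: (@ae_on_indic I _ (fun x y => (copson_operator I g x <= (fine V * `|y|)%:E)%E)) => //.
  apply: nearW => x Ix; rewrite indicE mem_set// normr1 mulr1 VE.
  exact: copV.
split; first exact: cg.
rewrite -VE; congr EFin; apply/eqP; rewrite eq_le; apply/andP; split.
  by move: ng; rewrite nI mulr1.
have := @derived_lower _ _ _ _ _ (copson_operator I) g _ (fine V) mg cS fV0 _ cg.
rewrite nS mulr1; apply.
apply: (@ae_on_indic I _ (fun x y => ((fine V * `|y|)%:E <= copson_operator I g x)%E)) => //.
apply: nearW => x Ix; rewrite indicE; have [xS|xS] := boolP (x \in S).
  rewrite normr1 mulr1 VE /= copVE//.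
  by move/set_mem: xS; rewrite /S /= in_itv/= => /andP[].
rewrite normr0 mulr0 /=; apply: integral_ge0 => t [/itv_of_ge0 t0 _].
by rewrite lee_fin divr_ge0.
Qed.

End L1Type.

(** * The Copson and Cesaro spaces of integrable functions *)

Section TonelliWeights.
Context {R : realType}.
Local Notation leb := (@lebesgue_measure R).
Local Notation base := (node_itv [::] : set R).
Implicit Types (I : base_itv) (x t : R) (g a b : R -> R).

(** Both the Cesaro and the Copson transform integrate over one side of the
    diagonal; their integrals are double integrals of such a kernel. *)
Definition half_plane_kernel a b (z : R * R) : \bar R :=
  (a z.1 * b z.2 * (z.1 <= z.2)%R%:R)%:E.

Lemma measurable_half_plane_kernel a b :
  measurable_fun setT a -> measurable_fun setT b ->
  measurable_fun setT (half_plane_kernel a b).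
Proof.
move=> ma mb; apply/measurable_EFinP; apply: measurable_funM.
  apply: measurable_funM.
  - exact: (measurableT_comp ma measurable_fst).
  - exact: (measurableT_comp mb measurable_snd).
rewrite (_ : (fun z : R * R => _) = fun z => if z.1 <= z.2 then 1 else 0).
  apply: measurable_fun_ifT => //.
  by apply: measurable_fun_ler; [exact: measurable_fst | exact: measurable_snd].
by apply/funext => z; case: (_ <= _).
Qed.

Lemma half_plane_kernel_ge0 a b z : (forall x, 0 <= a x) -> (forall t, 0 <= b t) ->
  (0 <= half_plane_kernel a b z)%E.
Proof. by move=> a0 b0; rewrite lee_fin !mulr_ge0. Qed.

Lemma tonelli_half_plane a b : measurable_fun setT a -> measurable_fun setT b ->
  (forall x, 0 <= a x) -> (forall t, 0 <= b t) ->
  (\int[leb]_x \int[leb]_t half_plane_kernel a b (x, t) =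
   \int[leb]_t \int[leb]_x half_plane_kernel a b (x, t))%E.
Proof.
move=> ma mb a0 b0; apply: (@fubini_tonelli _ _ _ _ _ leb leb).
  exact: measurable_half_plane_kernel.
by move=> z; exact: half_plane_kernel_ge0.
Qed.

(** By Tonelli's theorem |g(t)| / t is integrated over the x in [0, t], which
    gives back |g(t)|. *)
Lemma Cop_1_weight I g : measurable_fun setT g -> (forall x, ~ base x -> g x = 0) ->
  (\int[lebesgue_on I]_x copson_operator I g x =
   \int[leb]_(x in base) (`|g x| * cst 1 x)%:E)%E.
Proof.
move=> mg g0.
have mI : measurable ([set` itv_of I] : set R) by exact: measurable_itv.
have mk := measurable_norm_mul mg (@measurable_invr R).
rewrite integral_lebesgue_on; last 2 first.
- exact: (measurable_absop (copson_operator I) mg).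
- move=> x; apply: integral_ge0 => t [/itv_of_ge0 t0 _].
  by rewrite lee_fin mulr_ge0// invr_ge0.
pose a x : R := \1_[set` itv_of I] x.
pose b t : R := `|g t| * t^-1.
have ma : measurable_fun setT a by exact: measurable_indic.
have mb : measurable_fun setT b by exact/measurable_EFinP.
have a0 x : 0 <= a x by rewrite /a indicE.
have b0 t : 0 <= b t.
  have [/baseE bt|nbt] := pselect (base t); last by rewrite /b g0// normr0 mul0r.
  by rewrite mulr_ge0// invr_ge0; lra.
transitivity (\int[leb]_x \int[leb]_t half_plane_kernel a b (x, t))%E.
  rewrite integral_mkcond; apply: eq_integral => x _; rewrite patchE.
  rewrite /half_plane_kernel /a /= indicE.
  have [xI|xI] := boolP (x \in _); last first.
    by rewrite integral0_eq// => t _; rewrite !mul0r.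
  rewrite /Copson integral_mkcond; apply: eq_integral => t _; rewrite patchE /=.
  rewrite mul1r in_setI.
  have [tb|tb] := pselect (base t); last first.
    by rewrite /b g0// normr0 !mul0r; case: ifP.
  rewrite (mem_set (base_itv_of I tb))/=.
  have -> : (t \in `[x, +oo[%classic) = (x <= t).
    by apply/idP/idP => [/set_mem|h]; rewrite ?inE /= in_itv/= andbT.
  by case: (x <= t); rewrite ?mulr1// mulr0.
rewrite tonelli_half_plane// [RHS]integral_mkcond; apply: eq_integral => t _.
rewrite patchE /half_plane_kernel /=.
have [tb|tb] := boolP (t \in base); last first.
  rewrite integral0_eq// => x _; rewrite /b g0; last by move/negP: tb => h /mem_set.
  by rewrite normr0 mul0r mulr0 mul0r.
have /baseE t12 := set_mem tb.
rewrite (_ : (fun x => _) = fun x => ((b t)%:E * (\1_(`[0, t]%classic : set R) x)%:E)%E).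
  rewrite ge0_integralZl_EFin//; last first.
    apply/measurable_EFinP; exact: measurable_indic.
  rewrite integral_indic// setIT; transitivity ((b t)%:E * t%:E)%E.
    congr (_ * _)%E; rewrite [LHS]lebesgue_measure_itv/= lte_fin sube0.
    by have -> : 0 < t by lra.
  by rewrite -EFinM /b mulfVK ?mulr1// gt_eqF//; lra.
apply/funext => x; rewrite -EFinM; congr EFin; rewrite /a !indicE.
have [x0t|x0t] := boolP (x \in `[0, t]%classic).
  move/set_mem: x0t; rewrite /= in_itv/= => /andP[x0 xt].
  rewrite xt mem_set ?mul1r//; apply: itv_of_le1; lra.
rewrite mulr0; have [xI|] := boolP (x \in _); last by rewrite !mul0r.
have x0 := itv_of_ge0 (set_mem xI).
have -> : (x <= t) = false.
  by apply/negbTE; move: x0t; apply: contra => xt; rewrite inE/= in_itv/= x0.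
by rewrite mulr0.
Qed.

Theorem Cop_1_not_wfpp I : ~ wfpp (Cop_1 R I).
Proof.
refine (@weighted_L1_not_wfpp R I
  (CopsonSpace (Lp (lebesgue_on I) (lexx 1%E))) (cst 1) _ _ _) => //.
move=> g mg g0 gfin; have gE := Cop_1_weight I mg g0; rewrite -gE in gfin *.
exact: (@derived_L1 _ _ _ (lebesgue_on I) (copson_operator I) g mg gfin).
Qed.

Let recip_on_unit x : R := x^-1 * \1_(`[0, 1]%classic : set R) x.

Let measurable_recip_on_unit : measurable_fun setT recip_on_unit.
Proof. by apply: measurable_funM; [exact: measurable_invr | exact: measurable_indic]. Qed.

Let recip_on_unit_ge0 x : 0 <= recip_on_unit x.
Proof.
rewrite /recip_on_unit indicE; have [|] := boolP (x \in _); last by rewrite mulr0.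
by move/set_mem; rewrite /= in_itv/= => /andP[x0 _]; rewrite mulr1 invr_ge0.
Qed.

(** For t in ]0, 1], this is the integral of 1 / x over [t, 1], that is - ln t. *)
Let log_weight t : \bar R :=
  (\int[leb]_x half_plane_kernel (cst 1%R) recip_on_unit (t, x))%E.

Let measurable_log_weight : measurable_fun setT log_weight.
Proof.
apply: (@measurable_fun_fubini_tonelli_F _ _ _ _ _ leb).
  exact: measurable_half_plane_kernel.
by move=> z; exact: half_plane_kernel_ge0.
Qed.

Let measurable_kernel_section t : measurable_fun setT
  (fun x => half_plane_kernel (cst 1%R) recip_on_unit (t, x)).
Proof.
apply/measurable_EFinP; apply: measurable_funM; first exact: measurable_funM.
rewrite (_ : (fun x => _) = fun x => if t <= x then 1 else 0).
  by apply: measurable_fun_ifT => //; apply: measurable_fun_ler.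
by apply/funext => x /=; case: (_ <= _).
Qed.

Let log_weight_fin t : base t -> (0 < log_weight t < +oo)%E.
Proof.
move=> /baseE t12; rewrite /log_weight.
have mt : measurable (`[t, 1]%classic : set R) by exact: measurable_itv.
have m01 : measurable (`[0, 1]%classic : set R) by exact: measurable_itv.
have mk := measurable_kernel_section t.
have leb_itv (c : R) : c < 1 -> leb `[c, 1]%classic = (1 - c)%:E.
  by move=> c1; rewrite lebesgue_measure_itv/= lte_fin c1.
have k0 x : (0 <= half_plane_kernel (cst 1%R) recip_on_unit (t, x))%E.
  exact: half_plane_kernel_ge0.
apply/andP; split.
  apply: (@lt_le_trans _ _ (\int[leb]_x (\1_(`[t, 1]%classic : set R) x)%:E)%E).
    rewrite integral_indic// setIT; apply: (@lt_le_trans _ _ (1 - t)%:E).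
      by rewrite lte_fin; lra.
    by rewrite le_eqVlt; apply/orP; left; apply/eqP/esym/leb_itv; lra.
  apply: ge0_le_integral => //.
    by apply/measurable_EFinP; exact: measurable_indic.
  move=> x _; rewrite indicE; have [|_] := boolP (x \in _); last exact: k0.
  move/set_mem; rewrite /= in_itv/= => /andP[tx x1].
  rewrite /half_plane_kernel /= lee_fin tx mul1r mulr1 /recip_on_unit indicE.
  rewrite mem_set ?mulr1/= ?in_itv/=; last lra.
  by rewrite -[leLHS]invr1 lef_pV2// posrE; lra.
apply: (@le_lt_trans _ _ (\int[leb]_x (2%:E * (\1_(`[0, 1]%classic : set R) x)%:E))%E).
  apply: ge0_le_integral => //.
    apply: emeasurable_funM => //.
    by apply/measurable_EFinP; exact: measurable_indic.
  move=> x _; rewrite /half_plane_kernel /recip_on_unit /= -EFinM lee_fin mul1r.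
  rewrite indicE; have [|_] := boolP (x \in _); last by rewrite !mulr0 mul0r.
  move/set_mem; rewrite /= in_itv/= => /andP[x0 x1]; rewrite !mulr1.
  have [tx|_] := boolP (t <= x); last by rewrite mulr0.
  by rewrite mulr1 invf_ple ?posrE//; lra.
rewrite ge0_integralZl_EFin//; last first.
  by apply/measurable_EFinP; exact: measurable_indic.
rewrite integral_indic// setIT; apply: lte_mul_pinfty => //.
by apply: (le_lt_trans _ (ltry (1 - 0))); rewrite le_eqVlt; apply/orP; left;
  apply/eqP/leb_itv.
Qed.

Lemma Ces_1_weight g : measurable_fun setT g -> (forall x, ~ base x -> g x = 0) ->
  (\int[lebesgue_on UnitItv]_x cesaro_operator UnitItv g x =
   \int[leb]_(x in base) (`|g x| * fine (log_weight x))%:E)%E.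
Proof.
move=> mg g0.
have mg' : measurable_fun setT (fun t => `|g t|) by exact: measurableT_comp.
rewrite integral_lebesgue_on; last 2 first.
- exact: (measurable_absop (cesaro_operator UnitItv) mg).
- move=> x; have [x0|x0] := leP 0 x; last first.
    rewrite /= /Cesaro set_itv_ge ?integral_set0 ?mule0//.
    by rewrite -leNgt bnd_simp.
  apply: mule_ge0; first by rewrite lee_fin invr_ge0.
  by apply: integral_ge0 => t _; rewrite lee_fin.
transitivity (\int[leb]_x \int[leb]_t
    half_plane_kernel (fun t => `|g t|)%R recip_on_unit (t, x))%E.
  rewrite integral_mkcond; apply: eq_integral => x _; rewrite patchE.
  rewrite /half_plane_kernel /= /recip_on_unit /= indicE.
  have [xI|xI] := boolP (x \in _); last first.
    by rewrite integral0_eq// => t _; rewrite mulr0 mulr0 mul0r.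
  have x0 : 0 <= x by move/set_mem: xI => /(@itv_of_ge0 _ UnitItv).
  rewrite /Cesaro -ge0_integralZl_EFin//; last 2 first.
  - by apply: measurable_funTS; apply/measurable_EFinP.
  - by rewrite invr_ge0.
  rewrite integral_mkcond; apply: eq_integral => t _; rewrite patchE /=.
  have [tb|tb] := pselect (base t); last first.
    by rewrite g0// normr0 mule0 !mul0r; case: ifP.
  have /baseE t12 := tb.
  have -> : (t \in `[0, x]%classic) = (t <= x).
    by apply/idP/idP => [/set_mem|h]; rewrite ?inE /= in_itv/=; lra.
  rewrite mulr1; case: (t <= x); rewrite ?mulr1 ?mulr0// -EFinM mulrC//.
rewrite -tonelli_half_plane// [RHS]integral_mkcond; apply: eq_integral => t _.
rewrite patchE.
have [tb|tb] := boolP (t \in base); last first.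
  rewrite integral0_eq// => x _; rewrite /half_plane_kernel /= g0.
    by rewrite normr0 !mul0r.
  by move/negP: tb => h /mem_set.
have /andP[w0 woo] := log_weight_fin (set_mem tb).
rewrite EFinM fineK ?ge0_fin_numE// ?(ltW w0)// /log_weight.
rewrite -ge0_integralZl_EFin//; last 2 first.
- by move=> x _; exact: half_plane_kernel_ge0.
- exact: measurable_kernel_section.
apply: eq_integral => x _; rewrite /half_plane_kernel /= -EFinM.
by rewrite mul1r -[in LHS]mulrA.
Qed.

Theorem Ces_1_not_wfpp : ~ wfpp (Ces_1 R UnitItv).
Proof.
refine (@weighted_L1_not_wfpp R UnitItv
  (CesaroSpace (Lp (lebesgue_on UnitItv) (lexx 1%E))) (fine \o log_weight) _ _ _).
- exact: measurableT_comp.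
- by move=> x /log_weight_fin h; apply: fine_gt0.
move=> g mg g0 gfin; have gE := Ces_1_weight mg g0; rewrite -gE in gfin *.
exact: (@derived_L1 _ _ _ (lebesgue_on UnitItv) (cesaro_operator UnitItv) g mg gfin).
Qed.

End TonelliWeights.

(** * Sup-norm blocks in derived spaces *)

Section SupNormDerived.
Context {R : realType} (I : base_itv).
Variables (X : ideal_space (@lebesgue_on R I)) (op : abs_operator (@lebesgue_on R I)).
Variables (chi : L0 (@lebesgue_on R I)) (G : (nat -> R) -> R -> R).
Hypothesis Xchi : carrier X chi.
Hypothesis chi_neq0 : fnorm X chi != 0.
Hypothesis mG : forall c, measurable_fun setT (G c).
Hypothesis G_lin : forall a b c d x,
  G (fun m => a * c m + b * d m) x = a * G c x + b * G d x.
Hypothesis G_upper : forall c B, 0 <= B -> (forall m, `|c m| <= B) ->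
  \forall x \ae lebesgue_on I, (op (G c) x <= (B * `|chi x|)%:E)%E.
Hypothesis G_lower : forall c B e, 0 <= B -> 0 < e < 1 ->
  (forall N, exists2 m, (N <= m)%N & B <= `|c m|) ->
  exists chi' : L0 (@lebesgue_on R I),
    [/\ carrier X chi', fnorm X chi' = fnorm X chi &
    \forall x \ae lebesgue_on I, ((B * (1 - e) * `|chi' x|)%:E <= op (G c) x)%E].

(** G c is a function with value c(m) on the m-th block.  Its norm is the
    supremum of |c| in units of the norm of chi; the lower bound is only
    reached in the limit along the blocks where |c| is large, hence the
    margin e. *)
Theorem sup_norm_derived_not_wfpp : ~ wfpp (fspace (derived X op)).
Proof.
have chi_gt0 : 0 < fnorm X chi by rewrite lt_neqAle eq_sym chi_neq0 fnorm_ge0.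
pose emb c := embed (derived X op) (G c).
have embP c B : 0 <= B -> (forall m, `|c m| <= B) ->
    carrier (derived X op) (toL0 (lebesgue_on I) (G c)) /\
    `|emb c| <= B * fnorm X chi.
  move=> B0 cB.
  have [Ac nc] := @derived_upper _ _ _ (lebesgue_on I) X op (G c) chi B
    (mG c) Xchi B0 (G_upper B0 cB).
  by split; rewrite ?norm_embed.
have bounded_ge0 (c : nat -> R) B : (forall m, `|c m| <= B) -> 0 <= B.
  by move=> /(_ 0%N); exact: le_trans.
apply: (@sup_norm_blocks_not_wfpp _ _ (fun c => (fnorm X chi)^-1 *: emb c)).
- move=> a b c d [B cB] [D dD].
  have [Ac _] := embP c B (bounded_ge0 _ _ cB) cB.
  have [Ad _] := embP d D (bounded_ge0 _ _ dD) dD.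
  rewrite /emb (_ : G _ = fun x => a * G c x + b * G d x); last exact/funext/G_lin.
  rewrite embed_lin; [|exact: mG|exact: mG|exact: Ac|exact: Ad].
  by rewrite scalerDr !scalerA (mulrC a) (mulrC b).
- move=> c B cB; have [_ nc] := embP c B (bounded_ge0 _ _ cB) cB.
  by rewrite normrZ gtr0_norm ?invr_gt0// ler_pdivrMl// mulrC.
move=> c B [D cD] freq; have [B0|B0] := ltP B 0.
  exact: le_trans (ltW B0) (normr_ge0 _).
have [Ac _] := embP c D (bounded_ge0 _ _ cD) cD.
rewrite normrZ gtr0_norm ?invr_gt0// ler_pdivlMl// mulrC norm_embed//.
set n := fnorm (derived X op) _.
have lower e : 0 < e < 1 -> B * (1 - e) * fnorm X chi <= n.
  move=> e01; have [chi' [Xchi' <- h]] := G_lower B0 e01 freq.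
  have Be : 0 <= B * (1 - e) by rewrite mulr_ge0//; lra.
  exact: (@derived_lower _ _ _ (lebesgue_on I) X op (G c) chi' _ (mG c) Xchi' Be h Ac).
apply/ler_addgt0Pr => e e0; pose K := B * fnorm X chi.
have K0 : 0 <= K by rewrite mulr_ge0// ltW.
pose r := Num.min (2^-1) (e / (K + 1)).
have r01 : 0 < r < 1.
  by rewrite lt_min gt_min invr_gt0 ltr0n divr_gt0 ?ltr_wpDl//= invf_lt1// ltr1n.
have := lower r r01.
have -> : B * (1 - r) * fnorm X chi = K - r * K by rewrite /K; ring.
rewrite lerBlDr => /le_trans; apply; rewrite lerD2l.
apply: (@le_trans _ _ (e / (K + 1) * K)).
  by rewrite ler_wpM2r// ge_min lexx orbT.
by rewrite mulrAC ler_pdivrMr ?ltr_wpDl// ler_pM2l// lerDl.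
Qed.

End SupNormDerived.

Section FactorialBlocks.
Context {R : realType}.
Local Notation leb := (@lebesgue_measure R).
Implicit Types (m n : nat) (x : R) (c : nat -> R).

Definition inv_fact m : R := (m`!)%:R^-1.

(** The blocks fill ]0, 1] and shrink so fast that each one is, in proportion,
    almost all of the interval from 0 to its right end. *)
Definition block m : set R := `]inv_fact m.+1, inv_fact m]%classic.

(** Outside ]0, 1] the index is 0 by default, which keeps the values of
    c(block_index x) within the bounds of c. *)
Definition block_index x : nat := xget 0%N [set m | block m x].

Lemma inv_fact_gt0 m : 0 < inv_fact m.
Proof. by rewrite invr_gt0 ltr0n fact_gt0. Qed.

Lemma inv_factS m : inv_fact m.+1 = inv_fact m / m.+1%:R.
Proof. by rewrite /inv_fact factS natrM invfM mulrC. Qed.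

Lemma inv_fact_homo m n : (m <= n)%N -> inv_fact n <= inv_fact m.
Proof.
move=> mn; rewrite lef_pV2 ?posrE ?ltr0n ?fact_gt0// ler_nat.
exact: leq_fact.
Qed.

Lemma inv_fact_le1 m : inv_fact m <= 1.
Proof. by rewrite -[leRHS]invr1; exact: (@inv_fact_homo 0%N). Qed.

Lemma block_indexE m x : block m x -> block_index x = m.
Proof.
move=> mx; rewrite /block_index; case: xgetP => [n _ nx|/(_ m)//].
have lt i j : block i x -> block j x -> (i <= j)%N.
  rewrite /block /= !in_itv/= => /andP[_ xi] /andP[jx _].
  rewrite leqNgt; apply/negP => ji; have := inv_fact_homo ji.
  by move=> /(le_trans xi); rewrite leNgt jx.
by apply/eqP; rewrite eqn_leq !lt.
Qed.

Lemma measurable_block_index c : measurable_fun setT (fun x => c (block_index x)).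
Proof.
have mb m : measurable (block m) by exact: measurable_itv.
have mi m : measurable (block_index @^-1` [set m] : set R).
  rewrite (_ : _ @^-1` _ =
     block m `|` (if m == 0%N then ~` \bigcup_k block k else set0)).
    apply: measurableU; first exact: mb.
    case: ifP => // _; apply: measurableC; exact: bigcup_measurable.
  apply/seteqP; split => x /=.
    move=> <-; rewrite /block_index; case: xgetP => [n _ nx|no]; first by left.
    by right => /= -[k _]; exact: no.
  case=> [/block_indexE//|]; case: ifP => // /eqP -> no.
  by rewrite /block_index; case: xgetP => [n _ nx|//]; case: no; exists n.
move=> _ Y mY; rewrite setTI.
rewrite (_ : _ @^-1` _ = \bigcup_(m in [set m | Y (c m)]) (block_index @^-1` [set m])).
  by apply: bigcup_measurable.
by apply/seteqP; split => [x Yx|x [m Ym /= xm]]; [|by rewrite /= xm]; exists (block_index x).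
Qed.

End FactorialBlocks.

(** * The Cesaro space of bounded functions *)

Section SupType.
Context {R : realType}.
Local Notation leb := (@lebesgue_measure R).
#[local] Hint Extern 0 (Filter (nbhs (almost_everywhere _))) =>
  (exact: (ae_filter_ringOfSetsType leb)) : typeclass_instances.
Implicit Types (I : base_itv) (x t : R) (c : nat -> R).

Let cesaro_blocks c x : R := c (block_index x) * \1_(`]0, 1]%classic : set R) x.

Let measurable_cesaro_blocks c : measurable_fun setT (cesaro_blocks c).
Proof.
by apply: measurable_funM; [exact: measurable_block_index|exact: measurable_indic].
Qed.

Let integral_cst_itv (i : interval R) (l B : R) : leb [set` i] = l%:E ->
  (\int[leb]_(t in [set` i]) B%:E = (B * l)%:E)%E.
Proof.
move=> il; have mi : measurable ([set` i] : set R) by exact: measurable_itv.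
rewrite (@integral_cst _ _ _ leb _ mi B%:E) EFinM.
by congr (_ * _)%E; exact: il.
Qed.

Let cesaro_blocks_upper I c B : 0 <= B -> (forall m, `|c m| <= B) ->
  forall x, 0 < x -> (cesaro_operator I (cesaro_blocks c) x <= B%:E)%E.
Proof.
move=> B0 cB x x0; rewrite /= /Cesaro lee_pdivrMl// -EFinM.
have mx : measurable (`[0, x]%classic : set R) by exact: measurable_itv.
apply: (@le_trans _ _ (\int[leb]_(t in `[0%R, x]) (B%:E))%E).
  apply: ge0_le_integral => //.
    apply: measurable_funTS; apply/measurable_EFinP; apply: measurableT_comp => //.
    exact: measurable_cesaro_blocks.
  move=> t _; rewrite lee_fin /cesaro_blocks normrM -[leRHS]mulr1 ler_pM//.
  by rewrite indicE; case: (_ \in _); rewrite ?normr1 ?normr0.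
rewrite (@integral_cst_itv _ x); first by rewrite lee_fin mulrC.
by rewrite lebesgue_measure_itv/= lte_fin x0 sube0.
Qed.

(** On the right half of the m-th block, all but a proportion 2 / (m + 1) of the
    interval [0, x] belongs to that block, so the mean of the function over
    [0, x] is almost its value on the block. *)
Let cesaro_blocks_lower I c B e m : 0 <= B -> 0 < e < 1 -> B <= `|c m| ->
  (0 < m)%N -> 2 / m.+1%:R <= e ->
  forall x, inv_fact m / 2 < x <= inv_fact m ->
  ((B * (1 - e))%:E <= cesaro_operator I (cesaro_blocks c) x)%E.
Proof.
move=> B0 e01 Bc m0 me x /andP[xl xu].
have y0 := @inv_fact_gt0 R m; have y1 := @inv_fact_le1 R m.
have x0 : 0 < x by apply: lt_trans xl; rewrite divr_gt0.
pose y := inv_fact m.+1 : R.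
have yx : y <= e * x.
  rewrite /y inv_factS; apply: (@le_trans _ _ (e * (inv_fact m / 2))).
    have -> : inv_fact m / m.+1%:R = 2 / m.+1%:R * (inv_fact m / 2) :> R.
      have : (m.+1%:R : R) != 0 by rewrite pnatr_eq0.
      by move: (m.+1%:R : R) (inv_fact m) => k z k0; field.
    by rewrite ler_wpM2r// divr_ge0// ltW.
  by rewrite ler_pM2l ?(ltW xl)//; case/andP: e01.
have y_gt0 : 0 < y := inv_fact_gt0 m.+1.
have yx' : y < x by apply: (le_lt_trans yx); rewrite gtr_pMl//; case/andP: e01.
rewrite /= /Cesaro lee_pdivlMl// -EFinM.
have mx : measurable (`]y, x]%classic : set R) by exact: measurable_itv.
apply: (@le_trans _ _ (\int[leb]_(t in `]y, x]%classic) (B%:E))%E).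
  rewrite (@integral_cst_itv _ (x - y)).
    by rewrite lee_fin mulrCA ler_wpM2l//; lra.
  by rewrite lebesgue_measure_itv/= lte_fin yx'.
have mc : measurable_fun setT (fun t => (`|cesaro_blocks c t|)%:E).
  by apply/measurable_EFinP; apply: measurableT_comp.
apply: (@le_trans _ _ (\int[leb]_(t in `]y, x]%classic) (`|cesaro_blocks c t|)%:E)%E).
  apply: (@ge0_le_integral _ _ _ leb _ mx) => //.
    exact: measurable_funTS.
  move=> t; rewrite /= in_itv/= => /andP[yt tx]; rewrite lee_fin /cesaro_blocks.
  rewrite (@block_indexE _ m); last by rewrite /block /= in_itv/= yt (le_trans tx).
  rewrite indicE mem_set ?mulr1//= in_itv/=; lra.
apply: ge0_subset_integral => //; first exact: measurable_funTS.
by move=> t /=; rewrite !in_itv/=; lra.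
Qed.

Theorem Ces_oo_not_wfpp I : ~ wfpp (Ces_oo R I).
Proof.
have mI : measurable ([set` itv_of I] : set R) by exact: measurable_itv.
have I_gt0 : (0 < lebesgue_on I ([set` itv_of I] : set R))%E.
  apply: (@lebesgue_on_gt0 _ _ _ 0 1) => //.
    by apply: itv_of_le1; rewrite ler01 lexx.
  by move=> x /=; rewrite in_itv/= => x01; apply: itv_of_le1; lra.
have [cI nI] := @Linfty_indic _ (measurableTypeR R) R (lebesgue_on I) _ mI I_gt0.
refine (@sup_norm_derived_not_wfpp R I (Lp (lebesgue_on I) (leey 1))
  (cesaro_operator I) _ cesaro_blocks cI _ measurable_cesaro_blocks _ _ _).
- by rewrite nI oner_neq0.
- by move=> a b c d x; rewrite /cesaro_blocks; ring.
- move=> c B B0 cB.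
  apply: (@ae_on_indic _ I _ (fun x y =>
    (cesaro_operator I (cesaro_blocks c) x <= (B * `|y|)%:E)%E)) => //.
  have := @ae_neq R 0; apply: filterS => x x0 Ix.
  rewrite indicE mem_set// normr1 mulr1; apply: cesaro_blocks_upper => //.
  by rewrite lt_neqAle eq_sym x0 (itv_of_ge0 Ix).
move=> c B e B0 e01 freq.
have e0 : 0 < e by case/andP: e01.
have [m] := freq (Num.bound (2 / e)).+1; move=> mN Bc.
have m0 : (0 < m)%N by exact: leq_ltn_trans mN.
have me : 2 / m.+1%:R <= e.
  rewrite ler_pdivrMr ?ltr0n// -ler_pdivrMl// mulrC.
  apply: (@le_trans _ _ (Num.bound (2 / e))%:R); last first.
    by rewrite ler_nat (leq_trans _ (leqnSn _))// ltnW.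
  by have := archi_boundP (divr_ge0 (ler0n R 2) (ltW e0)) => /ltW.
pose S := `]inv_fact m / 2, inv_fact m]%classic : set R.
have mS : measurable S by exact: measurable_itv.
have y0 := @inv_fact_gt0 R m; have y1 := @inv_fact_le1 R m.
have S_gt0 : (0 < lebesgue_on I S)%E.
  apply: (@lebesgue_on_gt0 _ _ _ (inv_fact m / 2) (inv_fact m)) => //.
  - by lra.
  - by lra.
  - by apply: itv_of_le1; lra.
  - by move=> x /=; rewrite /S /= !in_itv/=; lra.
have [cS nS] := @Linfty_indic _ (measurableTypeR R) R (lebesgue_on I) _ mS S_gt0.
exists (toL0 (lebesgue_on I) \1_S); split; first exact: cS.
  by rewrite nS nI.
apply: (@ae_on_indic _ I _ (fun x y =>
  ((B * (1 - e) * `|y|)%:E <= cesaro_operator I (cesaro_blocks c) x)%E)) => //.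
apply: nearW => x Ix; rewrite indicE; have [xS|xS] := boolP (x \in S).
  rewrite normr1 mulr1; apply: (@cesaro_blocks_lower I c B e m) => //.
  by move/set_mem: xS; rewrite /S /= in_itv/=.
rewrite normr0 mulr0 /=; apply: mule_ge0; first by rewrite lee_fin invr_ge0 (itv_of_ge0 Ix).
by apply: integral_ge0 => t _; rewrite lee_fin.
Qed.

End SupType.

(** * Tandori spaces *)

Section Tandori.
Context {R : realType} (I : base_itv).
Local Notation leb := (@lebesgue_measure R).
#[local] Hint Extern 0 (Filter (nbhs (almost_everywhere _))) =>
  (exact: (ae_filter_ringOfSetsType leb)) : typeclass_instances.
Implicit Types (x t : R) (c : nat -> R) (f : R -> R).

Lemma majorant_antitone f x y : x <= y -> (majorant I f y <= majorant I f x)%E.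
Proof.
move=> xy; apply/ess_supP; apply/ae_restr.
have /ae_restr := ess_sup_ge (mrestr leb (measurable_itv_tail I x))
  (fun t => (`|f t|)%:E).
apply: filterS => t ht [It]; rewrite /= in_itv/= andbT => yt; apply: ht.
by split=> //=; rewrite in_itv/= andbT (le_trans xy).
Qed.

(** If the majorant vanished at almost every point, so would f. *)
Lemma exists_majorant_gt0 f : ~ (\forall x \ae lebesgue_on I, f x = 0) ->
  exists b, [/\ 0 < b, [set` itv_of I] b & (0 < majorant I f b)%E].
Proof.
move=> f_neq0; apply: contrapT => no; apply: f_neq0; apply: ae0_tail.
apply/ae_restr; have := @ae_neq R 0; apply: filterS => b b0 Ib.
have b_gt0 : 0 < b by rewrite lt_neqAle eq_sym b0 (itv_of_ge0 Ib).
have /ess_supP/ae_restr : (majorant I f b <= 0)%E.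
  by rewrite leNgt; apply/negP => mb; apply: no; exists b.
by apply: filterS => t ft /ft; rewrite lee_fin normr_le0 => /eqP.
Qed.

Section Blocks.
Variable b : R.
Hypotheses (b_gt0 : 0 < b) (Ib : [set` itv_of I] b).

(** The blocks are reflected so as to accumulate at b from the left: every
    tail [x, b[ contains all but finitely many of them, and the majorant is
    the constant sup |c| on [0, b[ when the large values of c recur. *)
Let blocks c x : R := c (block_index (b - x)) * \1_(`[0, b[%classic : set R) x.

Let measurable_blocks c : measurable_fun setT (blocks c).
Proof.
apply: measurable_funM; last exact: measurable_indic.
apply: (measurableT_comp (measurable_block_index c)).
by apply: measurable_funB.
Qed.

Let majorant_blocks_le c B x : 0 <= B -> (forall m, `|c m| <= B) -> 0 <= x ->
  (majorant I (blocks c) x <= (B * \1_(`[0%R, b]%classic : set R) x)%:E)%E.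
Proof.
move=> B0 cB x0; apply/ess_supP/ae_restr; apply: nearW => t [_]; rewrite /= in_itv/= andbT => xt.
rewrite lee_fin /blocks normrM ler_pM// !indicE.
have [tb|_] := boolP (t \in _); last by rewrite normr0.
rewrite mem_set ?normr1//=; move/set_mem: tb; rewrite /= !in_itv/=; lra.
Qed.

Let le_majorant_blocks c B x : (forall N, exists2 m, (N <= m)%N & B <= `|c m|) ->
  0 <= x < b -> (B%:E <= majorant I (blocks c) x)%E.
Proof.
move=> freq /andP[x0 xb]; rewrite leNgt; apply/negP => ltB.
have bx : 0 < b - x by rewrite subr_gt0.
have [m mN Bc] := freq (Num.bound (b - x)^-1).+1.
have m0 : (0 < m)%N by exact: leq_ltn_trans mN.
have y0 := @inv_fact_gt0 R m; have y1 := @inv_fact_gt0 R m.+1.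
have yS : inv_fact m.+1 < inv_fact m :> R.
  by rewrite inv_factS ltr_pdivrMr ?ltr0n// ltr_pMr// ltr1n.
have ybx : inv_fact m <= b - x.
  rewrite /inv_fact invf_ple ?posrE ?ltr0n ?fact_gt0//.
  apply: (@le_trans _ _ (Num.bound (b - x)^-1)%:R).
    by apply/ltW/archi_boundP; rewrite invr_ge0 ltW.
  by rewrite ler_nat (leq_trans _ (fact_geq m))// ltnW.
have small : \forall t \ae lebesgue_on I, itv_tail I x t -> `|blocks c t| < B.
  have /ae_restr := ess_sup_ge (mrestr leb (measurable_itv_tail I x))
    (fun t => (`|blocks c t|)%:E).
  move=> h; apply/ae_restr; apply: filterS h => t + _ xt => /(_ xt) ht.
  by rewrite -lte_fin (le_lt_trans ht).
have [|||t [lt tr It]] := @ae_between R I _ (b - inv_fact m) (b - inv_fact m.+1) _ _ _ small.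
- by lra.
- by rewrite ltrD2l ltrN2.
- by apply: itv_of_sub Ib; lra.
have xt : itv_tail I x t by split => //=; rewrite in_itv/= andbT; lra.
move=> /(_ xt); apply/negP; rewrite -leNgt /blocks.
rewrite (@block_indexE _ m); last by rewrite /block /= in_itv/=; lra.
by rewrite indicE mem_set ?mulr1//= in_itv/=; lra.
Qed.

Theorem Tandori_not_wfpp_of_indic (X : ideal_space (@lebesgue_on R I)) :
  carrier X (toL0 (lebesgue_on I) \1_`[0, b]%classic) ->
  ~ wfpp (fspace (TandoriSpace X)).
Proof.
have m0b : measurable (`[0, b]%classic : set R) by exact: measurable_itv.
move=> Xchi.
refine (@sup_norm_derived_not_wfpp R I X (majorant_operator I) _ blocks Xchi _
  measurable_blocks _ _ _).
- apply/eqP => /(fnorm_eq0 Xchi) chi0.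
  have : \forall x \ae lebesgue_on I, toL0 (lebesgue_on I) \1_`[0, b] x = 0.
    by rewrite chi0; exact: L00.
  move=> /ae_restr chi_ae.
  have : \forall x \ae lebesgue_on I, \1_(`[0, b]%classic : set R) x = 0 :> R.
    have /ae_restr cE := toL0E (lebesgue_on I) (measurable_indic m0b).
    by apply/ae_restr; apply: filterS2 chi_ae cE => x h1 h2 Ix; rewrite -h2 ?h1.
  move=> /(@ae_between R I _ 0 b (lexx 0) b_gt0 Ib)[x [x0 xb _]].
  rewrite indicE mem_set ?oner_neq0//= ?in_itv/= ?ltW//.
  by move=> /eqP; rewrite oner_eq0.
- by move=> a a' c d x; rewrite /blocks; ring.
- move=> c B B0 cB.
  apply: (@ae_on_indic _ I _ (fun x y =>
    (majorant_operator I (blocks c) x <= (B * `|y|)%:E)%E)) => //.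
  apply: nearW => x Ix; rewrite ger0_norm//.
  exact: majorant_blocks_le B0 cB (itv_of_ge0 Ix).
move=> c B e B0 /andP[e0 e1] freq.
exists (toL0 (lebesgue_on I) \1_`[0, b]%classic); split => //.
apply: (@ae_on_indic _ I _ (fun x y =>
  ((B * (1 - e) * `|y|)%:E <= majorant_operator I (blocks c) x)%E)) => //.
have /ae_restr M0 := absop_ge0 (majorant_operator I) (measurable_blocks c).
have := @ae_neq R b; apply: filterS2 M0 => x M0 xb Ix.
rewrite indicE; have [xS|_] := boolP (x \in _); last by rewrite normr0 mulr0 M0.
move/set_mem: xS; rewrite /= in_itv/= => /andP[x0 xleb].
rewrite normr1 mulr1; apply: (@le_trans _ _ B%:E).
  by rewrite lee_fin ler_piMr//; lra.
by apply: le_majorant_blocks => //; rewrite x0 lt_neqAle xb xleb.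
Qed.

End Blocks.

(** For a nonzero f of the Tandori space, the majorant of f is bounded below by
    a positive constant on some [0, b], so the ideal property puts the
    indicator of [0, b] in X. *)
Theorem Tandori_not_wfpp (X : banach_function_space R I) :
  carrier (TandoriSpace X) <> [set 0] -> ~ wfpp (fspace (TandoriSpace X)).
Proof.
move=> nontriv.
have [f [g fg Xg] f0] : exists2 f : L0 (@lebesgue_on R I),
    carrier (TandoriSpace X) f & f <> 0.
  apply: contrapT => no; apply: nontriv; apply/seteqP; split => [f Tf|_ ->].
    by apply: contrapT => f0; apply: no; exists f.
  exact: carrier0.
have [|b [b0 Ib mb]] := @exists_majorant_gt0 f.
  move=> h; apply: f0; apply/L0P.
  move: h (L00 (@lebesgue_on R I)) => /ae_restr h /ae_restr h0.
  apply/ae_restr; apply: filterS2 h h0 => x fx zx Ix.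
  by rewrite fx// zx.
apply: (Tandori_not_wfpp_of_indic b0 Ib).
have [d d0 dm] : exists2 d : R, 0 < d & (d%:E <= majorant I f b)%E.
  move: mb; case: (majorant I f b) => [r|_|//].
    by rewrite lte_fin => r0; exists r.
  by exists 1; rewrite ?leey.
have m0b : measurable (`[0, b]%classic : set R) by exact: measurable_itv.
have [] // := @idealP _ _ _ _ X (toL0 (lebesgue_on I) \1_`[0, b]%classic) (d^-1 *: g).
  exact: carrierZ.
apply: (@ae_on_indic _ I _ (fun x y => `|y| <= `|(d^-1 *: g : L0 _) x|)) => //.
move: fg (L0Z d^-1 g) => /ae_restr fg /ae_restr Zg.
apply: filterS2 fg Zg => x fg Zg Ix; rewrite Zg// indicE.
have [|_] := boolP (x \in _); last by rewrite normr0.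
move/set_mem; rewrite /= in_itv/= => /andP[x0 xb].
rewrite normr1 normrM gtr0_norm ?invr_gt0// ler_pdivlMl// mulr1.
apply: le_trans (ler_norm _); rewrite -lee_fin -fg//.
exact: le_trans dm (majorant_antitone _ xb).
Qed.

End Tandori.

(** * The spaces without the weak fixed point property *)

Theorem proposition7p5 (R : realType) :
  ~ wfpp (Ces_1 R UnitItv) /\
  forall I : base_itv,
    [/\ ~ wfpp (Ces_oo R I),
        ~ wfpp (Cop_1 R I),
        ~ wfpp (Cop_oo R I)
      & forall X : banach_function_space R I,
          carrier (TandoriSpace X) <> [set 0] ->
          ~ wfpp (fspace (TandoriSpace X))].
Proof.
split; first exact: Ces_1_not_wfpp.
move=> I; split.
- exact: Ces_oo_not_wfpp.
- exact: Cop_1_not_wfpp.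
- exact: Cop_oo_not_wfpp.
- by move=> X; exact: Tandori_not_wfpp.
Qed.
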